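(* Let $X^+=(X^+(t))_{t\ge 0}$ and $X^-=(X^-(t))_{t\ge0}$ be two continuous-time real-valued random processes, begun at the same fixed initial point, with càdlàg paths. Then a MEXIT coupling of $X^+$ and $X^-$ through all time exists.
   Context: A coupling of $X^+$ and $X^-$ is a pair $(\tilde X^+,\tilde X^-)$ of càdlàg processes defined on a common probability space such that $\tilde X^+$ has the law of $X^+$ and $\tilde X^-$ has the law of $X^-$. For probability measures $\mu^+,\mu^-$ on the same measurable space, the meet $\mu^+\wedge\mu^-$ is the largest non-negative measure $\tilde\mu$ with $\tilde\mu(D)\le\min\{\mu^+(D),\mu^-(D)\}$ for all measurable $D$. The coupling is a MEXIT (maximal exit) coupling through all time if for every $t>0$ $$\mathbb{P}\left[\tilde X^+(s)=\tilde X^-(s)\text{ for all }s<t\right]$$ equals the total mass of the meet measure $\mathcal{L}(X^+(s):0\le s<t)\wedge\mathcal{L}(X^-(s):0\le s<t)$, where $\mathcal{L}$ denotes the law as a process on the time interval $[0,t)$; equivalently, for every $t$ the probability of agreement throughout $[0,t)$ is the maximum possible. *)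

(* Defs.v *)
From HB Require Import structures.
From mathcomp Require Import all_boot all_order all_algebra.
From mathcomp Require Import all_classical all_reals all_analysis.
Set Implicit Arguments.
Unset Strict Implicit.
Unset Printing Implicit Defensive.
Import Order.TTheory GRing.Theory Num.Theory.
Import numFieldNormedType.Exports.
Local Open Scope classical_set_scope.
Local Open Scope ring_scope.

(* The time set is [0, +oo): a process is a family
   X : R -> T -> R of which only the values at times t >= 0 are ever used. *)

(* Left limits are required to be finite (convergence takes place in R). *)
Definition cadlag (R : realType) (f : R -> R) : Prop :=
  (forall t : R, 0 <= t -> f s @[s --> t^'+] --> f t) /\
  (forall t : R, 0 < t -> cvg (f s @[s --> t^'-])).

Definition cadlag_process (R : realType) (d : measure_display)
    (T : measurableType d) (X : R -> T -> R) : Prop :=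
  (forall t : R, 0 <= t -> measurable_fun setT (X t)) /\
  (forall w, cadlag (X ^~ w)).

(* Real paths on a time set I, with the product sigma-algebra, i.e. the one
   generated by the coordinate maps f |-> f t, t in I. *)
Definition coordinate_sets (R : realType) (I : set R) : set (set (I -> R)) :=
  \bigcup_t preimage_set_system setT (fun f : I -> R => f t) measurable.
Arguments coordinate_sets {R} I.

Definition path_space (R : realType) (I : set R) :=
  g_sigma_algebraType (coordinate_sets I).
Arguments path_space {R} I.

Definition restrict_path (R : realType) (d : measure_display) (T : measurableType d)
    (X : R -> T -> R) (I : set R) (w : T) : path_space I :=
  fun s : I => X (val s) w.
Arguments restrict_path {R d T} X I w.

Definition path_law (R : realType) (d : measure_display) (T : measurableType d)
    (P : probability T R) (X : R -> T -> R) (I : set R) :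
    set (path_space I) -> \bar R :=
  pushforward P (restrict_path X I).
Arguments path_law {R d T} P X I _.

Definition same_process_law (R : realType)
    (d1 d2 : measure_display) (T1 : measurableType d1) (T2 : measurableType d2)
    (P1 : probability T1 R) (P2 : probability T2 R)
    (X1 : R -> T1 -> R) (X2 : R -> T2 -> R) : Prop :=
  forall A : set (path_space (`[0, +oo[%classic : set R)), measurable A ->
    path_law P1 X1 _ A = path_law P2 X2 _ A.

Definition below_both (R : realType) (d : measure_display)
    (T : measurableType d) (mu nu m : set T -> \bar R) : Prop :=
  forall D, measurable D -> (m D <= Order.min (mu D) (nu D))%E.

Definition is_meet (R : realType) (d : measure_display)
    (T : measurableType d) (mu nu : set T -> \bar R)
    (m : {measure set T -> \bar R}) : Prop :=
  below_both mu nu m /\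
  forall m' : {measure set T -> \bar R}, below_both mu nu m' ->
    forall D, measurable D -> (m' D <= m D)%E.

Definition is_coupling (R : realType)
    (d1 d2 d : measure_display) (T1 : measurableType d1)
    (T2 : measurableType d2) (T : measurableType d)
    (P1 : probability T1 R) (P2 : probability T2 R) (P : probability T R)
    (X1 : R -> T1 -> R) (X2 : R -> T2 -> R) (Y1 Y2 : R -> T -> R) : Prop :=
  [/\ cadlag_process Y1, cadlag_process Y2,
      same_process_law P P1 Y1 X1 & same_process_law P P2 Y2 X2].

(* The meet is unique on measurable sets, so "there is a meet with the
   prescribed total mass" says that the meet exists and has that mass. *)
Definition is_mexit_coupling (R : realType)
    (d1 d2 d : measure_display) (T1 : measurableType d1)
    (T2 : measurableType d2) (T : measurableType d)
    (P1 : probability T1 R) (P2 : probability T2 R) (P : probability T R)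
    (X1 : R -> T1 -> R) (X2 : R -> T2 -> R) (Y1 Y2 : R -> T -> R) : Prop :=
  is_coupling P1 P2 P X1 X2 Y1 Y2 /\
  forall t : R, 0 < t ->
    exists m : {measure set (path_space (`[0, t[%classic : set R)) -> \bar R},
      is_meet (path_law P1 X1 `[0, t[) (path_law P2 X2 `[0, t[) m /\
      P [set w | forall s : R, 0 <= s -> s < t -> Y1 s w = Y2 s w] = m setT.

(* Main.v *)
Require Import Defs.
From HB Require Import structures.
From mathcomp Require Import all_boot all_order all_algebra.
From mathcomp Require Import all_classical all_reals all_analysis.
From mathcomp Require Import measurable_realfun.
From mathcomp Require Import lra.

(** Agreement on [0, t) is monotone in t, so a maximal exit coupling has to be
    optimal simultaneously for a whole chain of questions.

    For two laws on a finite set and a chain of partitions, this is solved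
    greedily from the finest partition to the coarsest: at each stage, what is
    still unmatched inside a block is matched, as much as possible, with what is
    still unmatched inside the same block. Matching inside finer blocks removes
    equal masses from the two laws, so the total matched inside a block always
    reaches the minimum of the two masses of that block, which is the mass of
    the meet there ([mexit_finite]).

    A càdlàg path is determined by the countably many bits saying whether its
    value at a grid time lies below a rational threshold, and agreement of two
    paths on [0, t) is agreement of the bits attached to times before t. For
    every k, the greedy construction applies to the first k bits, the partitions
    being given by the bits with time before t, for the finitely many relevant t
    ([mask_coupling]). The couplings of the first k bits need not be consistent
    as k grows, but spaces of finite bit strings are finite, so an ultrafilter
    limit of their finite-dimensional masses exists and is consistent; it is
    realized by nested subintervals of [0, 1) ([sequence_compactness]). Lower
    bounds on the mass of an event depending on finitely many bits survive the
    limit, hence so do both marginals, and so does the lower bound on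
    agreement: agreement of the first n relevant bits is implied by agreement
    of the first k for k >= n, and agreement of all of them is a decreasing
    limit.

    The bits are turned back into paths by [path_of]. That this is possible
    measurably rests on a description of the grid values of càdlàg paths by
    countably many conditions on three grid points ([cadlag_regular],
    [fill_cadlag]). Finally, the mass of the meet on [0, t) is at most the mass
    of the meet of the laws of the first k bits, for every k
    ([meet_le_meet_mass]), hence at most the probability of agreement, and the
    reverse inequality holds for every coupling ([coupling_inequality]). *)

Import Order.TTheory GRing.Theory Num.Theory.
Import numFieldNormedType.Exports.
Local Open Scope classical_set_scope.
Local Open Scope ring_scope.
Set Implicit Arguments.
Unset Strict Implicit.
Unset Printing Implicit Defensive.

(** * Finitely valued maps *)

Lemma measurable_bool_fiber d (T : measurableType d) (f : T -> bool) (c : bool) :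
  measurable_fun setT f -> measurable [set w | f w = c].
Proof.
by move=> mf; rewrite -[X in measurable X]setTI; exact: (mf measurableT [set c]).
Qed.

Section finite_fibers.
Context d (T : measurableType d) (C : finType) (F : T -> C).
Hypothesis mF : forall c, measurable [set w | F w = c].

Let fibersE (phi : pred C) :
  [set w | phi (F w)] = \bigcup_(c in [set c | phi c]) [set w | F w = c].
Proof.
by apply/seteqP; split=> w /= => [phiw|[c phic ->]//]; exists (F w).
Qed.

Lemma measurable_fibers (phi : pred C) : measurable [set w | phi (F w)].
Proof.
rewrite fibersE; apply: fin_bigcup_measurable => //; exact: finite_finset.
Qed.

Lemma measure_fibers (R : realType) (mu : {measure set T -> \bar R})
    (phi : pred C) :
  mu [set w | phi (F w)] = (\sum_(c | phi c) mu [set w | F w = c])%E.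
Proof.
rewrite fibersE measure_fin_bigcup //; last 2 first.
- exact: finite_finset.
- by move=> b c _ _ [w [/= <-]].
rewrite (fsbigE (enum phi)) ?enum_uniq //.
- rewrite big_enum_cond /=; apply: eq_bigl => c.
  by rewrite andb_idr //; rewrite unfold_in => phic; rewrite inE.
- by move=> c /=; rewrite mem_enum.
- by move=> c /= phic; rewrite mem_enum [in X in ~~ X]unfold_in phic.
Qed.

End finite_fibers.

(** * Greedy couplings on a finite set *)

Record subcoupling (R : realFieldType) (T : finType) (mu nu : T -> R)
    (K : T -> T -> R) : Prop := Subcoupling {
  subcoupling_ge0 : forall x y, 0 <= K x y;
  subcoupling_row : forall x, \sum_y K x y <= mu x;
  subcoupling_col : forall y, \sum_x K x y <= nu y }.

Definition fiber_mass (R : realFieldType) (T U : finType) (p : T -> U)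
  (mu : T -> R) (c : U) : R := \sum_(x | p x == c) mu x.

Definition meet_mass (R : realFieldType) (T U : finType) (p : T -> U)
  (mu nu : T -> R) : R :=
  \sum_c Num.min (fiber_mass p mu c) (fiber_mass p nu c).

Lemma mul_div_max (R : realFieldType) (a b : R) :
  0 <= a -> 0 <= b -> a * b / Num.max a b = Num.min a b.
Proof.
move=> a0 b0; case: (leP a b) => ab.
  have [bz|bn0] := eqVneq b 0; last by rewrite mulfK.
  by rewrite bz mulr0 mul0r; lra.
have an0 : a != 0 by rewrite gt_eqF // (le_lt_trans b0).
by rewrite mulrAC mulfV // mul1r.
Qed.

(** Inside a block, the residual masses r and s of the two laws are matched by
    their product divided by the larger of their totals: the row sums are then
    at most r, the column sums at most s, and the total is the smaller of the
    two totals. A kernel supported on the blocks has taken the same mass from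
    both laws in each block, so adding this brings the matched mass to the
    minimum of the two block masses. *)
Lemma subcoupling_extend (R : realFieldType) (T U : finType) (p : T -> U)
    (mu nu : T -> R) (K : T -> T -> R) :
  subcoupling mu nu K -> (forall x y, K x y != 0 -> p x = p y) ->
  exists K' : T -> T -> R, [/\ subcoupling mu nu K',
    forall x y, K x y <= K' x y,
    forall x y, K' x y != 0 -> p x = p y &
    meet_mass p mu nu <= \sum_x \sum_(y | p x == p y) K' x y].
Proof.
move=> [K0 Krow Kcol] Kp.
have KZ x y : p x <> p y -> K x y = 0.
  by move=> pxy; apply/eqP; apply: contra_notT pxy => /Kp.
pose r x := mu x - \sum_y K x y; pose s y := nu y - \sum_x K x y.
have r0 x : 0 <= r x by rewrite subr_ge0.
have s0 x : 0 <= s x by rewrite subr_ge0.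
pose rc := fiber_mass p r; pose sc := fiber_mass p s.
have rc0 c : 0 <= rc c by apply: sumr_ge0.
have sc0 c : 0 <= sc c by apply: sumr_ge0.
pose M c := Num.max (rc c) (sc c).
have M0 c : 0 <= M c by rewrite le_max rc0.
pose N x y := if p x == p y then r x * s y / M (p x) else 0.
have N0 x y : 0 <= N x y.
  by rewrite /N; case: ifP => // _; rewrite divr_ge0 // mulr_ge0.
have Nrow x : \sum_y N x y = r x * sc (p x) / M (p x).
  rewrite -big_mkcond /= /sc /fiber_mass mulr_sumr mulr_suml.
  by apply: eq_bigl => y; rewrite eq_sym.
have Ncol y : \sum_x N x y = rc (p y) * s y / M (p y).
  rewrite -big_mkcond /= /rc /fiber_mass !mulr_suml.
  by apply: eq_bigr => x /eqP ->.
have le1 a c : 0 <= a -> a <= M c -> a / M c <= 1.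
  move=> a0 aM; have [->|Mn] := eqVneq (M c) 0; first by rewrite invr0 mulr0.
  by rewrite ler_pdivrMr ?mul1r // lt_neqAle eq_sym Mn M0.
exists (fun x y => K x y + N x y); split.
- split=> [x y|x|y]; first exact: addr_ge0.
  + rewrite big_split /= Nrow -lerBrDl -/(r x) -mulrA ler_piMr //.
    by apply: le1 => //; rewrite le_max lexx orbT.
  + rewrite big_split /= Ncol -lerBrDl -/(s y) mulrAC ler_piMl //.
    by apply: le1 => //; rewrite le_max lexx.
- by move=> x y; rewrite lerDl.
- move=> x y; apply: contra_neqP => pxy; rewrite /N.
  by case: eqP => // _; rewrite addr0 KZ.
- have KE x : \sum_(y | p x == p y) K x y = \sum_y K x y.
    rewrite [RHS](bigID (fun y => p x == p y)) /= [X in _ + X]big1 ?addr0 //.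
    by move=> y; apply: contraNeq => /Kp ->.
  have NE x : \sum_(y | p x == p y) N x y = \sum_y N x y.
    rewrite [RHS](bigID (fun y => p x == p y)) /= [X in _ + X]big1 ?addr0 //.
    by move=> y; rewrite /N => /negbTE ->.
  rewrite (partition_big p predT) //= /meet_mass; apply: ler_sum => c _.
  under eq_bigr do rewrite big_split /= KE NE Nrow.
  rewrite big_split /=.
  have -> : \sum_(x | p x == c) (r x * sc (p x) / M (p x)) =
      Num.min (rc c) (sc c).
    rewrite -mul_div_max // !mulr_suml; apply: eq_bigr => x /eqP ->.
    by [].
  have rcE : fiber_mass p mu c = \sum_(x | p x == c) \sum_y K x y + rc c.
    by rewrite -big_split /=; apply: eq_bigr => x _; rewrite /r addrC subrK.
  have scE : fiber_mass p nu c = \sum_(x | p x == c) \sum_y K x y + sc c.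
    have -> : \sum_(x | p x == c) \sum_y K x y =
              \sum_(y | p y == c) \sum_x K x y.
      rewrite (exchange_big_dep predT) //= [RHS]big_mkcond /=.
      apply: eq_bigr => y _.
      rewrite [LHS]big_mkcond /=; case: ifP => [/eqP pyc|pyc].
        apply: eq_bigr => x _; case: ifPn => // pxc.
        by rewrite KZ // => pxy; rewrite pxy pyc eqxx in pxc.
      rewrite big1 // => x _; case: ifP => // /andP[/eqP pxc _].
      by rewrite KZ // => pxy; rewrite -pxy pxc eqxx in pyc.
    by rewrite -big_split /=; apply: eq_bigr => x _; rewrite /s addrC subrK.
  by rewrite rcE scE addr_minr.
Qed.

(** Mass placed at a fine level joins points that are still equivalent at every
    coarser level, so the extension step applies again, and since kernels only
    grow the optimality reached at the finer levels is kept. *)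
Lemma greedy_subcoupling (R : realFieldType) (T U : finType) (mu nu : T -> R)
    (p : nat -> T -> U) (n : nat) :
  (forall x, 0 <= mu x) -> (forall x, 0 <= nu x) ->
  (forall j x y, p j x = p j y -> p j.+1 x = p j.+1 y) ->
  exists K : T -> T -> R, [/\ subcoupling mu nu K,
    forall x y, K x y != 0 -> p n x = p n y &
    forall j, (j <= n)%N ->
      meet_mass (p j) mu nu <= \sum_x \sum_(y | p j x == p j y) K x y].
Proof.
move=> mu0 nu0 pS; elim: n => [|n [K [Ksub Kp Kmass]]].
  have Z : subcoupling mu nu (fun _ _ => 0).
    by split=> // x; rewrite big1.
  have [|K [Ksub _ Kp Kmass]] := subcoupling_extend (p := p 0%N) Z.
    by move=> x y; rewrite eqxx.
  by exists K; split=> // j; rewrite leqn0 => /eqP ->.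
have [|K' [K'sub KK' K'p K'mass]] := subcoupling_extend (p := p n.+1) Ksub.
  by move=> x y /Kp /pS.
exists K'; split=> // j; rewrite leq_eqVlt => /orP[/eqP -> //|jn].
apply: le_trans (Kmass j jn) _.
by do 2 (apply: ler_sum => ? _).
Qed.

(** At the coarsest level there is one block and both laws have mass 1 there, so
    the greedy subcoupling has total mass 1 and its marginals are exact. *)
Lemma mexit_finite (R : realFieldType) (T U : finType) (mu nu : T -> R)
    (p : nat -> T -> U) (n : nat) :
  (forall x, 0 <= mu x) -> (forall x, 0 <= nu x) ->
  \sum_x mu x = 1 -> \sum_x nu x = 1 ->
  (forall j x y, p j x = p j y -> p j.+1 x = p j.+1 y) ->
  (forall x y, p n x = p n y) ->
  exists K : T -> T -> R, [/\ forall x y, 0 <= K x y,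
    forall x, \sum_y K x y = mu x, forall y, \sum_x K x y = nu y &
    forall j, (j <= n)%N ->
      meet_mass (p j) mu nu <= \sum_x \sum_(y | p j x == p j y) K x y].
Proof.
move=> mu0 nu0 mu1 nu1 pS pn.
have [K [[K0 Krow Kcol] _ Kmass]] := greedy_subcoupling n mu0 nu0 pS.
have [x0 _] : exists x0 : T, true.
  case: (pickP (@predT T)) => [x0|T0]; first by exists x0.
  by move: mu1; rewrite big_pred0 // => /esym/eqP; rewrite oner_eq0.
have K1 : 1 <= \sum_x \sum_y K x y.
  have := Kmass n (leqnn n); rewrite /meet_mass (bigD1 (p n x0)) //=.
  have fib (m : T -> R) : \sum_x m x = 1 -> fiber_mass (p n) m (p n x0) = 1.
    by move=> <-; apply: eq_bigl => x; rewrite (pn x x0) eqxx.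
  rewrite !fib // minxx => /(le_trans _) h.
  apply: le_trans (h _ _) _; first rewrite lerDl sumr_ge0 // => c _.
    by rewrite le_min !sumr_ge0.
  apply: ler_sum => x _; rewrite big_mkcond /=; apply: ler_sum => y _.
  by case: ifP.
(* A nonnegative defect whose sum is at most 0 vanishes everywhere. *)
have tight (m k : T -> R) : (forall x, k x <= m x) -> \sum_x m x = 1 ->
    1 <= \sum_x k x -> forall x, k x = m x.
  move=> km m1 k1 x; apply/eqP; rewrite -subr_eq0; apply/eqP.
  have /eqP : \sum_x (m x - k x) = 0.
    apply/eqP; rewrite eq_le sumr_ge0 ?andbT; last by move=> y _; rewrite subr_ge0.
    by rewrite sumrB m1 subr_le0.
  rewrite psumr_eq0; last by move=> y _; rewrite subr_ge0.
  move=> /allP /(_ x (mem_index_enum _)) /=.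
  by rewrite subr_eq0 => /eqP ->; rewrite subrr.
exists K; split=> //; first exact: tight.
by apply: tight => //; rewrite exchange_big.
Qed.

(** * Random sequences with prescribed finite-dimensional laws *)

(** A consistent family of masses of words is realized on [0, 1) with Lebesgue
    measure: the cell of a word s is an interval of length p s, cut into
    consecutive intervals of lengths p (rcons s a) for the letters a, and the
    sequence attached to a point lists the letters of the cells around it. *)
Section nested_cells.
Context (R : realType) (A : finType) (a0 : A) (p : seq A -> R).
Hypothesis p_ge0 : forall s, 0 <= p s.
Hypothesis p_nil : p [::] = 1.
Hypothesis p_rcons : forall s, p s = \sum_a p (rcons s a).

Let offset (s : seq A) (a : A) :=
  \sum_(b | (enum_rank b < enum_rank a)%N) p (rcons s b).

(* Words grow at the end, hence the recursion on the reversed word. *)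
Let Fixpoint left_rev (s : seq A) : R :=
  if s is a :: s' then left_rev s' + offset (rev s') a else 0.

Let left s := left_rev (rev s).

Let left_rcons s a : left (rcons s a) = left s + offset s a.
Proof. by rewrite /left rev_rcons /= revK. Qed.

Let cell s : set R := `[left s, left s + p s[.

Let cellE s u : cell s u = (left s <= u < left s + p s) :> Prop.
Proof. by rewrite /cell /= in_itv. Qed.

Let offsetD s a c : (enum_rank a < enum_rank c)%N ->
  offset s a + p (rcons s a) <= offset s c.
Proof.
move=> ac; rewrite /offset [leRHS](bigD1 a) //= [leLHS]addrC lerD2l.
rewrite [leRHS](bigID (fun b => (enum_rank b < enum_rank a)%N)) /=.
rewrite -[leLHS]addr0 lerD ?sumr_ge0 //.
rewrite le_eqVlt; apply/orP; left; apply/eqP; apply: eq_bigl => b.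
case: ltnP => ba; rewrite ?andbF // andbT (ltn_trans ba ac) /=.
by apply/esym/eqP => bE; rewrite bE ltnn in ba.
Qed.

Let offset_le s a : offset s a + p (rcons s a) <= p s.
Proof.
rewrite (p_rcons s) (bigD1 a) //= [leLHS]addrC lerD2l /offset.
rewrite [leRHS](bigID (fun b => (enum_rank b < enum_rank a)%N)) /=.
rewrite -[leLHS]addr0 lerD ?sumr_ge0 //.
rewrite le_eqVlt; apply/orP; left; apply/eqP; apply: eq_bigl => b.
case: ltnP => ba; rewrite ?andbF // andbT.
by apply/esym/eqP => bE; rewrite bE ltnn in ba.
Qed.

Let cell_sub s a : cell (rcons s a) `<=` cell s.
Proof.
move=> u; rewrite !cellE left_rcons => /andP[lu ur].
have := offset_le s a; have : 0 <= offset s a by apply: sumr_ge0.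
by move=> ? ?; apply/andP; split; lra.
Qed.

Let cell_disjoint s a b u : cell (rcons s a) u -> cell (rcons s b) u -> a = b.
Proof.
rewrite !cellE !left_rcons => /andP[lau uar] /andP[lbu ubr].
apply: enum_rank_inj; apply/val_inj => /=.
by case: (ltngtP (enum_rank a) (enum_rank b)) => // /(offsetD s) ?;
  exfalso; lra.
Qed.

Let cell_split s u : cell s u -> exists a, cell (rcons s a) u.
Proof.
rewrite cellE => /andP[lu ur].
pose cum j := left s + \sum_(b | (enum_rank b < j)%N) p (rcons s b).
have ex : exists j, u < cum j.
  exists #|A|; rewrite /cum (eq_bigl predT) -?p_rcons // => b.
  exact: ltn_ord.
case: (ex_minnP ex) => -[|i] ui imin.
  by move: ui; rewrite /cum big_pred0_eq addr0 ltNge lu.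
have ciu : cum i <= u by rewrite leNgt; apply/negP => /imin; rewrite ltnn.
have iA : (i < #|A|)%N.
  rewrite ltnNge; apply/negP => Ai; move: ui; rewrite ltNge => /negP; apply.
  apply: le_trans ciu; rewrite /cum lerD2l le_eqVlt; apply/orP; left; apply/eqP.
  apply: eq_bigl => b; have bA : (enum_rank b < i)%N.
    exact: leq_trans (ltn_ord _) Ai.
  by rewrite bA ltnW.
exists (enum_val (Ordinal iA)); rewrite cellE left_rcons /offset enum_valK /=.
rewrite ciu /=; move: ui; rewrite /cum (bigD1 (enum_val (Ordinal iA))) /=;
  last by rewrite enum_valK.
rewrite (addrC (p _)) addrA (eq_bigl (fun b => (enum_rank b < i)%N)) //.
move=> b; rewrite ltnS ltn_neqAle andbC; congr (_ && _).
by rewrite -(inj_eq enum_rank_inj) enum_valK.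
Qed.

Let next s u : A := odflt a0 [pick a | `[< cell (rcons s a) u >]].

Let nextP s u a : cell (rcons s a) u -> next s u = a.
Proof.
rewrite /next => ua; case: pickP => [b /asboolP ub|/(_ a)/asboolPn //].
exact: cell_disjoint ub ua.
Qed.

Let Fixpoint word n u : seq A :=
  if n is n'.+1 then rcons (word n' u) (next (word n' u) u) else [::].

Let digit n u : A := next (word n u) u.

Let word_mkseq n u : mkseq (digit ^~ u) n = word n u.
Proof. by elim: n => //= n IHn; rewrite mkseqS IHn. Qed.

Let cell_nil : cell [::] = `[0, 1[%classic.
Proof. by rewrite /cell p_nil /left /= add0r. Qed.

Let word_cell n u : `[0, 1[%classic u -> cell (word n u) u.
Proof.
rewrite -cell_nil => u01; elim: n => //= n /cell_split[a ua].
by rewrite (nextP ua).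
Qed.

Let cell_word s u : cell s u -> word (size s) u = s.
Proof.
elim/last_ind: s => //= s a IHs ua; rewrite size_rcons /= IHs ?(nextP ua) //.
exact: cell_sub ua.
Qed.

Let cell01 s : cell s `<=` `[0, 1[%classic.
Proof.
rewrite -cell_nil; elim/last_ind: s => // s a IHs.
by move=> u /cell_sub /IHs.
Qed.

Let measurable_cell s : measurable (cell s : set (measurableTypeR R)).
Proof. exact: measurable_itv. Qed.

Let measurable_next s a :
  measurable ([set u | next s u = a] : set (measurableTypeR R)).
Proof.
have -> : [set u | next s u = a] = cell (rcons s a) `|`
    (if a == a0 then ~` \bigcup_b cell (rcons s b) else set0).
  apply/seteqP; split=> u /=.
    move=> ua; have [[b ub]|nb] := pselect (exists b, cell (rcons s b) u).
      by left; rewrite -ua (nextP ub).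
    right; have -> : a == a0.
      rewrite -ua /next; case: pickP => [b /asboolP ub|//].
      by case: nb; exists b.
    by move=> [b _ ub]; apply: nb; exists b.
  move=> [/nextP //|]; case: eqP => [-> nb|//].
  rewrite /next; case: pickP => [b /asboolP ub|//].
  by case: nb; exists b.
apply: measurableU => //; case: ifP => // _; apply: measurableC.
by apply: countable_bigcupT_measurable => //; exact: countableP.
Qed.

Let measurable_word n s :
  measurable ([set u | word n u = s] : set (measurableTypeR R)).
Proof.
elim: n s => [|n IHn] s /=.
  by have [->|/eqP ns] := eqVneq [::] s; [rewrite (_ : [set _ | _] = setT)|
    rewrite (_ : [set _ | _] = set0)] => //; apply/seteqP; split.
elim/last_ind: s => [|s a _].
  by rewrite (_ : [set _ | _] = set0) //; apply/seteqP; split => // u /=;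
    case: (word n u).
rewrite (_ : [set _ | _] = [set u | word n u = s] `&` [set u | next s u = a]).
  exact: measurableI.
apply/seteqP; split=> u /=; last by move=> [-> ->].
by move=> /rcons_inj [<-].
Qed.

Lemma digit_sequence : exists (d : measure_display) (T : measurableType d)
    (P : probability T R) (Z : nat -> T -> A),
  (forall n s, measurable [set w | mkseq (Z ^~ w) n = s]) /\
  (forall s, P [set w | mkseq (Z ^~ w) (size s) = s] = (p s)%:E).
Proof.
have m01 : measurable (`[0, 1[%classic : set (measurableTypeR R)).
  exact: measurable_itv.
pose mu : {measure set (measurableTypeR R) -> \bar R} :=
  mrestr (@lebesgue_measure R) m01.
have muT : mu setT = 1%E.
  by rewrite /mu /= /mrestr setTI lebesgue_measure_itv /= lte_fin ltr01 oppr0 adde0.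
pose PM := Measure_isProbability.Build _ _ _ mu muT.
pose P : probability (measurableTypeR R) R := HB.pack (Measure.sort mu) PM.
exists _, (measurableTypeR R), P, digit; split=> [n s|s].
  by under eq_fun do rewrite word_mkseq; exact: measurable_word.
rewrite /P /= /mrestr.
have -> : [set w | mkseq (digit ^~ w) (size s) = s] `&` `[0, 1[ = cell s.
  apply/seteqP; split=> u /=; rewrite word_mkseq.
    by move=> [us u01]; rewrite -us; exact: word_cell.
  by move=> us; split; [exact: cell_word|exact: (cell01 us)].
rewrite lebesgue_measure_itv /= lte_fin ltrDl.
case: ltP => [_|]; first by rewrite -EFinB addrAC subrr add0r.
by move=> ps; congr (_%:E); apply/eqP; rewrite eq_le p_ge0 ps.
Qed.

End nested_cells.

Lemma ultra_cvg01 (R : realType) (I : Type) (F : set_system I) (u : I -> R) :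
  UltraFilter F -> (forall i, 0 <= u i <= 1) -> exists l : R, u i @[i --> F] --> l.
Proof.
move=> FU u01.
have PF : ProperFilter (fmap u F) by exact: fmap_proper_filter.
have [|l [_ ul]] := segment_compact (a := 0) (b := 1) PF.
  by apply: (@filterS _ F _ setT) => [i _|]; [rewrite /= in_itv /=|exact: filterT].
exists l => V Vl; rewrite /fmap /=.
have [//|FV] := in_ultra_setVsetC (u @^-1` V) FU.
by have [|x [/= nVx /nVx]] := ul (~` V) V _ Vl.
Qed.

Lemma take_rcons_eq (A : finType) (a0 : A) (k : nat) (z : k.-tuple A)
    (s : seq A) (a : A) : (size s < k)%N ->
  (take (size s).+1 z == rcons s a) =
  (take (size s) z == s) && (nth a0 z (size s) == a).
Proof.
move=> sk; rewrite (take_nth a0) ?size_tuple //.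
by rewrite eqseq_rcons.
Qed.

(** Compactness of the laws of sequences in a finite alphabet, for laws Q k on
    words of length k that need not be consistent. The conclusion speaks of
    lower bounds only; applied to an event and to its complement it also
    transports probabilities that do not depend on k. *)
Lemma sequence_compactness (R : realType) (A : finType) (a0 : A)
    (Q : forall k : nat, k.-tuple A -> R) :
  (forall k z, 0 <= Q k z) -> (forall k, \sum_z Q k z = 1) ->
  exists (d : measure_display) (T : measurableType d)
    (P : probability T R) (Z : nat -> T -> A),
  (forall n s, measurable [set w | mkseq (Z ^~ w) n = s]) /\
  (forall n (phi : pred (seq A)) (c : R),
    (\forall k \near \oo, c <= \sum_(z : k.-tuple A | phi (take n z)) Q k z) ->
    (c%:E <= P [set w | phi (mkseq (Z ^~ w) n)])%E).
Proof.
move=> Q0 Q1; have [F [FU Foo]] := @ultraFilterLemma nat \oo _.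
pose q (s : seq A) k := \sum_(z : k.-tuple A | take (size s) z == s) Q k z.
have q01 s k : 0 <= q s k <= 1.
  rewrite /q sumr_ge0 //= -(Q1 k) 
    [leRHS](bigID (fun z : k.-tuple A => take (size s) z == s)) /=.
  by rewrite lerDl sumr_ge0.
have /choice[p qp] s : exists l : R, q s k @[k --> F] --> l.
  exact: ultra_cvg01.
have near_gt n : \forall k \near F, (n < k)%N by apply: Foo; exact: nbhs_infty_gt.
have p0 s : 0 <= p s.
  apply: (closed_cvg _ (@closed_ge _ (0 : R)) _ _ (qp s)) => //.
  by apply: nearW => k; case/andP: (q01 s k).
have p_nil : p [::] = 1.
  apply: (cvg_unique _ (qp [::])) => //.
  apply: cvg_near_cst; apply: nearW => k; rewrite /q -(Q1 k).
  by apply: eq_bigl => z; rewrite take0 eqxx.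
have p_rcons s : p s = \sum_a p (rcons s a).
  apply: (cvg_unique _ (qp s)) => //.
  have : (\sum_a q (rcons s a) k) @[k --> F] --> \sum_a p (rcons s a).
    by apply: cvg_big => [|a _]; [exact: add_continuous|exact: qp].
  apply: cvg_trans; apply: near_eq_cvg; near=> k.
  have sk : (size s < k)%N by near: k; exact: near_gt.
  rewrite /q [RHS](partition_big (fun z : k.-tuple A => nth a0 z (size s)) predT) //=.
  apply: eq_bigr => a _; apply: eq_bigl => z.
  by rewrite size_rcons (take_rcons_eq a0).
have [d [T [P [Z [mZ PZ]]]]] := digit_sequence a0 p0 p_nil p_rcons.
exists d, T, P, Z; split=> // n phi c Qphi.
pose W w := [tuple of mkseq (Z ^~ w) n].
have WE w : tval (W w) = mkseq (Z ^~ w) n by [].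
have WsE (s : n.-tuple A) :
    [set w | W w = s] = [set w | mkseq (Z ^~ w) n = s].
  by apply/seteqP; split=> w /= [Ws]; [rewrite -Ws|apply: val_inj].
have mW s : measurable [set w | W w = s] by rewrite WsE.
rewrite (_ : [set _ | _] = [set w | [pred s : n.-tuple A | phi s] (W w)]) //.
rewrite (measure_fibers mW).
have PW (s : n.-tuple A) : P [set w | W w = s] = (p s)%:E.
  by rewrite WsE -PZ size_tuple.
rewrite (eq_bigr (fun s : n.-tuple A => (p s)%:E)); last by move=> s _; exact: PW.
rewrite sumEFin lee_fin.
have cv : (\sum_(s : n.-tuple A | phi s) q s k) @[k --> F] -->
    \sum_(s : n.-tuple A | phi s) p s.
  by apply: cvg_big => [|s _]; [exact: add_continuous|exact: qp].
apply: (closed_cvg _ (@closed_ge _ c) _ _ cv) => //.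
have Fphi := Foo _ Qphi.
near=> k.
have nk : (n < k)%N by near: k; exact: near_gt.
rewrite /= (le_trans (near Fphi k _)) //.
have st (z : k.-tuple A) : size (take n z) == n.
  by rewrite size_takel // size_tuple ltnW.
rewrite (partition_big (fun z : k.-tuple A => Tuple (st z)) (fun s => phi s)) //=.
apply: ler_sum => s phis; rewrite /q size_tuple.
rewrite le_eqVlt; apply/orP; left; apply/eqP; apply: eq_bigl => z.
rewrite -val_eqE /= andb_idl //.
by move=> /eqP ->.
Unshelve. all: end_near. Qed.

(** * Càdlàg paths and their values on a countable grid *)

Definition grid (R : realType) (i : nat * nat) : R := i.1%:R / i.2.+1%:R.
Arguments grid {R} i.

(** Grid points converging to t from the right and different from t: the path
    recovered from arbitrary grid values is then right-continuous, even at grid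
    times where the grid values are not. *)
Definition after (R : realType) (t : R) (n : nat) : nat * nat :=
  ((Num.truncn (t * n.+1%:R)).+1, n).

(** Among three nearby grid times, the middle value is close to one of its
    neighbours. This three-point oscillation condition, familiar from the
    Skorokhod topology, excludes two large jumps within a short time but allows
    single ones, and being uniform on bounded time intervals it consists of
    countably many conditions. The non-strict inequalities between times also
    cover different indices of the same time. *)
Definition regular (R : realType) (x : nat * nat -> R) : Prop :=
  forall N k : nat, exists n : nat, forall i j l : nat * nat,
    grid i <= grid j :> R -> grid j <= grid l :> R -> grid j <= N%:R :> R ->
    grid l - grid i < n.+1%:R^-1 :> R ->
    `|x i - x j| <= k.+1%:R^-1 :> R \/ `|x j - x l| <= k.+1%:R^-1 :> R.

Definition fill (R : realType) (x : nat * nat -> R) (t : R) : R :=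
  lim (x (after t n) @[n --> \oo]).

Lemma exists_inv_lt (R : realType) (e : R) :
  0 < e -> exists k : nat, k.+1%:R^-1 < e :> R.
Proof. by move=> /ltr_add_invr[k]; rewrite add0r; exists k. Qed.

Lemma grid_ge0 (R : realType) i : 0 <= grid i :> R.
Proof. by rewrite /grid divr_ge0. Qed.

Lemma grid_after_gt (R : realType) (t : R) n : 0 <= t -> t < grid (after t n).
Proof.
by move=> t0; rewrite /grid /after /= ltr_pdivlMr // truncnS_gt.
Qed.

Lemma grid_after_le (R : realType) (t : R) n :
  0 <= t -> grid (after t n) <= t + n.+1%:R^-1.
Proof.
move=> t0; rewrite /grid /after /= ler_pdivrMr // mulrDl mulVf ?pnatr_eq0 //.
by rewrite -natr1 lerD2r truncn_le mulr_ge0.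
Qed.

Lemma grid_after_near (R : realType) (t b : R) : 0 <= t -> t < b ->
  \forall n \near \oo, t < grid (after t n) < b.
Proof.
move=> t0 tb; have bt0 : 0 < b - t by rewrite subr_gt0.
near=> n; rewrite grid_after_gt //= (le_lt_trans (grid_after_le n t0)) //.
by rewrite -ltrBrDl; near: n; exact: (near_infty_natSinv_lt (PosNum bt0)).
Unshelve. all: end_near. Qed.

Lemma grid_after_cvg (R : realType) (t : R) :
  0 <= t -> grid (after t n) @[n --> \oo] --> t.
Proof.
move=> t0; apply/cvgrPdist_lt => e e0.
have te : t < t + e by rewrite ltrDl.
apply: filterS (grid_after_near t0 te) => n /andP[tg ge].
by rewrite distrC gtr0_norm ?subr_gt0 // ltrBlDl.
Qed.

(** Right-continuity controls the path on [t, t + d) and the left limit controls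
    it on (t - d, t); a jump at t is invisible to each of the two parts. *)
Lemma cadlag_local (R : realType) (f : R -> R) (t e : R) :
  cadlag f -> 0 <= t -> 0 < e -> exists2 d : R, 0 < d &
    (forall u v : R, t <= u < t + d -> t <= v < t + d -> `|f u - f v| <= e) /\
    (forall u v : R, 0 <= u -> 0 <= v -> t - d < u < t -> t - d < v < t ->
       `|f u - f v| <= e).
Proof.
move=> [fr fl] t0 e0; have e20 : 0 < e / 2 by rewrite divr_gt0.
have [d1 d10 fd1] : exists2 d : R, 0 < d &
    forall u : R, t <= u < t + d -> `|f t - f u| < e / 2.
  have /cvgrPdist_lt /(_ _ e20) /nbhs_ballP[d d0 fd] := fr _ t0.
  exists d => // u /andP[]; rewrite le_eqVlt => /orP[/eqP <- _|tu ud].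
    by rewrite subrr normr0.
  apply: fd => //; rewrite /ball /= distrC gtr0_norm ?subr_gt0 //.
  by rewrite ltrBlDl.
have [d2 d20 fd2] : exists2 d : R, 0 < d &
    forall u v : R, 0 <= u -> 0 <= v -> t - d < u < t -> t - d < v < t ->
       `|f u - f v| <= e.
  have [tE|tn0] := eqVneq t 0.
    by exists 1 => // u v u0 _ /andP[_]; rewrite tE ltNge u0.
  have [l fl_l] : exists l : R, f s @[s --> t^'-] --> l.
    by apply/cvg_ex; apply: fl; rewrite lt_neqAle eq_sym tn0.
  have /cvgrPdist_lt /(_ _ e20) /nbhs_ballP[d d0 fd] := fl_l.
  have fdl u : t - d < u < t -> `|l - f u| < e / 2.
    move=> /andP[du ut]; apply: fd => //; rewrite /ball /=.
    by rewrite gtr0_norm ?subr_gt0 // ltrBlDr -ltrBlDl.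
  exists d => // u v _ _ /fdl lu /fdl lv.
  by have := ler_distD l (f u) (f v); rewrite (distrC (f u) l) => ?; lra.
exists (Num.min d1 d2); first by rewrite lt_min d10.
have m1 : Num.min d1 d2 <= d1 by rewrite ge_min lexx.
have m2 : Num.min d1 d2 <= d2 by rewrite ge_min lexx orbT.
split=> [u v /andP[tu ud] /andP[tv vd]|u v u0 v0 /andP[ud ut] /andP[vd vt]].
  have := fd1 u; have := fd1 v.
  rewrite tu tv /= (lt_le_trans ud) ?lerD2l // (lt_le_trans vd) ?lerD2l //.
  move=> /(_ isT) ftv /(_ isT) ftu.
  by have := ler_distD (f t) (f u) (f v); rewrite (distrC (f u) (f t)) => ?; lra.
by apply: fd2; rewrite // ?ut ?vt andbT; lra.
Qed.

(** Around t, a triple of times has its last two in [t, t + d) if its middle time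
    is at least t, and its first two in (t - d, t) otherwise. Compactness of
    [0, N] makes d uniform. *)
Lemma cadlag_regular (R : realType) (f : R -> R) :
  cadlag f -> regular (fun i => f (grid i)).
Proof.
move=> fc N k; set e : R := k.+1%:R^-1.
have e0 : 0 < e by rewrite invr_gt0.
pose ok (n : nat) (u : R) := forall i j l : nat * nat,
  grid i <= grid j :> R -> grid j <= grid l :> R ->
  `|grid j - u| < n.+1%:R^-1 :> R -> grid l - grid i < n.+1%:R^-1 :> R ->
  `|f (grid i) - f (grid j)| <= e \/ `|f (grid j) - f (grid l)| <= e.
have near_ok (t : R) : 0 <= t -> \forall u \near t & n \near \oo, ok n u.
  move=> t0; have [d d0 [fr fl]] := cadlag_local fc t0 e0.
  have d40 : 0 < d / 4 by rewrite divr_gt0.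
  exists (ball t (d / 2), [set n | n.+1%:R^-1 < d / 4 :> R]).
    split => /=; first by apply: nbhsx_ballx; rewrite divr_gt0.
    exact: (near_infty_natSinv_lt (PosNum d40)).
  move=> [u n] /= [+ nd] i j l ij jl; rewrite /ball /= !ltr_distlC.
  move: (n.+1%:R^-1 : R) nd => q qd /andP[tu1 tu2] /andP[ju1 ju2] il.
  have [jt|tj] := ltP (grid j : R) t.
    by left; apply: fl; rewrite ?grid_ge0 //; apply/andP; split; lra.
  by right; apply: fr; apply/andP; split; lra.
have /compact_near_coveringP cover := @segment_compact R 0 N%:R.
have [t /= /[!in_itv] /= /andP[t0 _]|m _ okm] := cover nat \oo ok _ _.
  exact: near_ok.
exists m => i j l ij jl jN il; apply: (okm m (leqnn m) (grid j)) => //.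
  by rewrite /= in_itv /= grid_ge0.
by rewrite subrr normr0 invr_gt0.
Qed.

(** If the grid values oscillated by more than e arbitrarily close to t on the
    right, there would be a pair j, l with such an oscillation and, still closer
    to t, another one; one point i of the latter is e / 2 away from j, and i, j,
    l contradict regularity. *)
Lemma regular_right (R : realType) (x : nat * nat -> R) (t e : R) :
  regular x -> 0 < e -> exists2 d : R, 0 < d &
    forall j l, t < grid j < t + d -> t < grid l < t + d ->
      `|x j - x l| <= e.
Proof.
move=> xr e0; apply: contrapT => nd.
have bad (d : R) : 0 < d -> exists j l : nat * nat,
    [/\ t < grid j :> R, grid j <= grid l :> R, grid l < t + d :> R &
      e < `|x j - x l|].
  move=> d0; apply: contrapT => nb; apply: nd; exists d => // j l.
  move=> /andP[tj jd] /andP[tl ld]; rewrite leNgt; apply/negP => jl.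
  apply: nb; case: (leP (grid j : R) (grid l)) => [jl'|/ltW lj].
    by exists j, l.
  by exists l, j; rewrite distrC.
have e20 : 0 < e / 2 by rewrite divr_gt0.
have [k ke] := exists_inv_lt e20.
have [n xn] := xr (Num.truncn (t + 1)).+1 k.
have q0 : 0 < n.+1%:R^-1 :> R by rewrite invr_gt0.
move: (k.+1%:R^-1 : R) (n.+1%:R^-1 : R) ke q0 xn => r q re q0 xn.
have [d [d0 d1 dq]] : exists d : R, [/\ 0 < d, d <= 1 & d <= q].
  by exists (Num.min 1 q); rewrite lt_min ltr01 q0 !ge_min !lexx orbT.
have [j [l [tj jl lt xjl]]] := bad _ d0.
have tj0 : 0 < grid j - t by rewrite subr_gt0.
have [j' [l' [tj' jl' lt' xjl']]] := bad _ tj0.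
have [i [ti ij xij]] : exists i : nat * nat,
    [/\ t < grid i :> R, grid i <= grid j :> R & e / 2 < `|x i - x j|].
  have [|] := ltP (e / 2) `|x j' - x j|.
    by exists j'; split=> //; lra.
  exists l'; split; [lra|lra|].
  by have := ler_distD (x j) (x j') (x l'); rewrite (distrC (x j) (x l')) => ?; lra.
have jN : grid j <= (Num.truncn (t + 1)).+1%:R :> R.
  by have ? := truncnS_gt (t + 1); lra.
have [||] := xn i j l ij jl jN; [lra|move=> ?; lra|move=> ?; lra].
Qed.

(** Mirror image of the argument on the right: the extra point is found after
    the pair. *)
Lemma regular_left (R : realType) (x : nat * nat -> R) (t e : R) :
  regular x -> 0 < e -> exists2 d : R, 0 < d &
    forall j l, t - d < grid j < t -> t - d < grid l < t ->
      `|x j - x l| <= e.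
Proof.
move=> xr e0; apply: contrapT => nd.
have bad (d : R) : 0 < d -> exists j l : nat * nat,
    [/\ t - d < grid j :> R, grid j <= grid l :> R, grid l < t :> R &
      e < `|x j - x l|].
  move=> d0; apply: contrapT => nb; apply: nd; exists d => // j l.
  move=> /andP[tj jd] /andP[tl ld]; rewrite leNgt; apply/negP => jl.
  apply: nb; case: (leP (grid j : R) (grid l)) => [jl'|/ltW lj].
    by exists j, l.
  by exists l, j; rewrite distrC.
have e20 : 0 < e / 2 by rewrite divr_gt0.
have [k ke] := exists_inv_lt e20.
have [n xn] := xr (Num.truncn t).+1 k.
have d0 : 0 < n.+1%:R^-1 :> R by rewrite invr_gt0.
move: (k.+1%:R^-1 : R) (n.+1%:R^-1 : R) ke d0 xn => r d re d0 xn.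
have [j [l [tj jl lt xjl]]] := bad _ d0.
have tl0 : 0 < t - grid l by rewrite subr_gt0.
have [j' [l' [tj' jl' lt' xjl']]] := bad _ tl0.
have [i [it li xil]] : exists i : nat * nat,
    [/\ grid i < t :> R, grid l <= grid i :> R & e / 2 < `|x l - x i|].
  have [|] := ltP (e / 2) `|x l - x j'|.
    by exists j'; split=> //; lra.
  exists l'; split; [lra|lra|].
  by have := ler_distD (x l) (x j') (x l'); rewrite (distrC (x j') (x l)) => ?; lra.
have lN : grid l <= (Num.truncn t).+1%:R :> R.
  by have ? := truncnS_gt t; lra.
have [||] := xn j l i jl li lN; [lra|move=> ?; lra|move=> ?; lra].
Qed.

Lemma fill_cvg (R : realType) (x : nat * nat -> R) (t : R) :
  regular x -> 0 <= t -> x (after t n) @[n --> \oo] --> fill x t.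
Proof.
move=> xr t0; apply: (@cauchy_cvg R); apply: cauchy_exP => e e0.
have e20 : 0 < e / 2 by rewrite divr_gt0.
have [d d0 xd] := regular_right t xr e20.
have td : t < t + d by rewrite ltrDl.
have [m _ tm] := grid_after_near t0 td.
exists (x (after t m)); exists m => // n mn.
have xmn : `|x (after t m) - x (after t n)| <= e / 2.
  by apply: xd; apply: tm => //=.

by rewrite /preimage /= /ball /=; apply: le_lt_trans xmn _; lra.
Qed.

(** The left end a is allowed for s and u, because their approximating grid
    points lie strictly to the right; this is what gives right-continuity. *)
Lemma fill_dist_le (R : realType) (x : nat * nat -> R) (a b e s u : R) :
  regular x ->
  (forall j l, a < grid j < b -> a < grid l < b -> `|x j - x l| <= e) ->
  0 <= s -> 0 <= u -> a <= s < b -> a <= u < b ->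
  `|fill x s - fill x u| <= e.
Proof.
move=> xr xe s0 u0 /andP[as_ sb] /andP[au ub].
have xs j : a < grid j < b -> `|fill x s - x j| <= e.
  move=> abj.
  have cv : `|x (after s n) - x j| @[n --> \oo] --> `|fill x s - x j|.
    by apply: cvg_norm; apply: cvgB; [exact: fill_cvg|exact: cvg_cst].
  apply: (closed_cvg _ (@closed_le _ e) _ _ cv) => //.
  apply: filterS (grid_after_near s0 sb) => n /andP[sn nb].
  by apply: xe => //; rewrite nb andbT (le_lt_trans as_).
have cv : `|fill x s - x (after u n)| @[n --> \oo] --> `|fill x s - fill x u|.
  by apply: cvg_norm; apply: cvgB; [exact: cvg_cst|exact: fill_cvg].
apply: (closed_cvg _ (@closed_le _ e) _ _ cv) => //.
apply: filterS (grid_after_near u0 ub) => n /andP[un nb].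
by apply: xs; rewrite nb andbT (le_lt_trans au).
Qed.

Lemma fill_cadlag (R : realType) (x : nat * nat -> R) :
  regular x -> cadlag (fill x).
Proof.
move=> xr; split=> t t0.
  apply/cvgrPdist_le => e e0; have [d d0 xd] := regular_right t xr e0.
  near=> s; apply: (fill_dist_le xr xd) => //.
  - by apply: le_trans t0 _; near: s; exact: nbhs_right_ge.
  - by rewrite lexx ltrDl.
  - apply/andP; split; first by near: s; exact: nbhs_right_ge.
    by near: s; apply: nbhs_right_lt; rewrite ltrDl.
apply: (@cauchy_cvg R); apply: cauchy_exP => e e0.
have e20 : 0 < e / 2 by rewrite divr_gt0.
have [d d0 xd] := regular_left t xr e20.
pose a : R := Num.max 0 (t - d / 2).
have at_ : a < t by rewrite /a gt_max t0 /=; lra.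
have ad : t - d < a by rewrite /a lt_max; apply/orP; right; lra.
have a0 : 0 <= a by rewrite /a le_max lexx.
exists (fill x a).
change (\forall s \near t^'-, ball (fill x a : R) e (fill x s)); near=> s.
suff xas : `|fill x a - fill x s| <= e / 2.
  have {}xas : `|fill x a - fill x s| < e by lra.
  rewrite /ball /=; exact xas.
have as_ : a <= s by near: s; exact: nbhs_left_ge.
have st : s < t by near: s; exact: nbhs_left_lt.
apply: (fill_dist_le xr xd) => //; first exact: le_trans as_.
- by rewrite at_ ltW.
- by rewrite st andbT ltW // (lt_le_trans ad).
Unshelve. all: end_near. Qed.

Lemma fill_grid (R : realType) (f : R -> R) (t : R) :
  cadlag f -> 0 <= t -> fill (fun i => f (grid i)) t = f t.
Proof.
move=> [fr _] t0; apply/cvg_lim => //.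
move/cvg_at_rightP: (fr t t0); apply; split; last exact: grid_after_cvg.
by move=> n; exact: grid_after_gt.
Qed.

(** * Coding of paths by bit sequences *)

Definition prefix_sets : set (set (nat -> bool)) :=
  [set C | exists n (phi : pred (seq bool)), C = [set b | phi (mkseq b n)]].

(** The sets depending on a finite prefix form an algebra, in particular a class
    closed under intersection, that generates the product sigma-algebra. *)
Definition bit_space := g_sigma_algebraType prefix_sets.

Lemma measurable_prefix n (phi : pred (seq bool)) :
  measurable ([set b | phi (mkseq b n)] : set bit_space).
Proof. by apply: sub_sigma_algebra; exists n, phi. Qed.

Lemma measurable_bit n : measurable_fun setT (fun b : bit_space => b n).
Proof.
apply: (measurable_fun_bool true); rewrite setTI.
rewrite (_ : _ @^-1` _ =
  [set b | [pred s : seq bool | nth false s n] (mkseq b n.+1)]).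
  exact: measurable_prefix.
by apply/seteqP; split=> b /=; rewrite nth_mkseq.
Qed.

Section bit_sequences.
Context d (T : measurableType d) (B : T -> nat -> bool).
Hypothesis mB : forall n s, measurable [set w | mkseq (B w) n = s].

Let prefixE n (phi : pred (seq bool)) : [set w | phi (mkseq (B w) n)] =
  [set w | [pred s : n.-tuple bool | phi s] [tuple of mkseq (B w) n]].
Proof. by []. Qed.

Let mW n (s : n.-tuple bool) :
  measurable [set w | [tuple of mkseq (B w) n] = s].
Proof.
rewrite (_ : [set w | _] = [set w | mkseq (B w) n = s]) //.
apply/seteqP; split=> w /= [Ws]; first by rewrite -Ws.
exact: val_inj.
Qed.

Lemma measurable_mkseq n (phi : pred (seq bool)) :
  measurable [set w | phi (mkseq (B w) n)].
Proof. by rewrite prefixE; apply: (measurable_fibers (@mW n)). Qed.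

Lemma measure_mkseq (R : realType) (mu : {measure set T -> \bar R}) n
    (phi : pred (seq bool)) :
  mu [set w | phi (mkseq (B w) n)] =
  (\sum_(s : n.-tuple bool | phi s) mu [set w | mkseq (B w) n = s])%E.
Proof.
rewrite prefixE (measure_fibers (@mW n)); apply: eq_bigr => s _.
congr (mu _); apply/seteqP; split=> w /= [Ws]; first by rewrite -Ws.
exact: val_inj.
Qed.

Lemma measurable_to_bits : measurable_fun setT (B : T -> bit_space).
Proof.
apply: (@measurability _ _ _ bit_space setT B prefix_sets) => // _ [_ [n [phi ->]] <-].
rewrite setTI; exact: measurable_mkseq.
Qed.

End bit_sequences.

Lemma measurable_mkseq_bits d (T : measurableType d) (B : T -> nat -> bool) :
  (forall n, measurable [set w | B w n]) ->
  forall n s, measurable [set w | mkseq (B w) n = s].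
Proof.
move=> mB; elim=> [|n IHn] s.
  have [<-|/eqP ns] := eqVneq [::] s; [rewrite (_ : [set _ | _] = setT)|
    rewrite (_ : [set _ | _] = set0)] => //; apply/seteqP; split => //.
elim/last_ind: s => [|s a _].
  rewrite (_ : [set _ | _] = set0) //; apply/seteqP; split => // w /=.
rewrite (_ : [set _ | _] = [set w | mkseq (B w) n = s] `&`
    (if a then [set w | B w n] else ~` [set w | B w n])).
  by apply: measurableI => //; case: a => //; exact: measurableC.
apply/seteqP; split=> w /=; rewrite mkseqS.
  by move=> /rcons_inj [<- <-]; split=> //; case: ifP => //= ->.
by case: a => -[<-]; [move=> ->|move=> /negP/negbTE ->].
Qed.

Lemma bit_law_unique (R : realType) d1 d2 (T1 : measurableType d1)
    (T2 : measurableType d2) (P1 : probability T1 R) (P2 : probability T2 R)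
    (B1 : T1 -> bit_space) (B2 : T2 -> bit_space) :
  measurable_fun setT B1 -> measurable_fun setT B2 ->
  (forall n (phi : pred (seq bool)),
     P1 [set w | phi (mkseq (B1 w) n)] = P2 [set w | phi (mkseq (B2 w) n)]) ->
  forall A, measurable A -> P1 (B1 @^-1` A) = P2 (B2 @^-1` A).
Proof.
move=> mB1 mB2 PB A mA.
pose m1 : {measure set bit_space -> \bar R} := pushforward P1 B1.
pose m2 : {measure set bit_space -> \bar R} := pushforward P2 B2.
change (m1 mB1 A = m2 mB2 A).
refine (@measure_unique _ R bit_space prefix_sets (fun=> setT) _ _ _ _
  (m1 mB1) (m2 mB2) _ _ A mA) => //.
- move=> _ _ [n [phi ->]] [m [psi ->]]; exists (maxn n m).
  exists [pred s | phi (take n s) && psi (take m s)].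
  have tk k (b : nat -> bool) : (k <= maxn n m)%N ->
      take k (mkseq b (maxn n m)) = mkseq b k.
    by move=> kl; rewrite /mkseq -map_take take_iota (minn_idPl kl).
  apply/seteqP; split=> b /=; rewrite !tk ?leq_maxl ?leq_maxr //.
    by move=> [-> ->].
  by move=> /andP[].
- by move=> _; exists 0%N, predT; apply/seteqP; split.
- by apply/seteqP; split=> // b _; exists 0%N.
- by move=> _ [n [phi ->]]; exact: PB.
- by move=> _; rewrite /m1 /= /pushforward preimage_setT probability_setT ltry.
Qed.

Definition bit_index (n : nat) : (nat * nat) * rat :=
  odflt ((0, 0)%N, 0) (unpickle n).

Definition bit_time (R : realType) (n : nat) : R := grid (bit_index n).1.

Definition bits_of (R : realType) (f : R -> R) (n : nat) : bool :=
  f (bit_time R n) < ratr (bit_index n).2.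

(** The infimum of the rational thresholds lying above the coded value. It is
    taken in the extended reals so as to be measurable on all bit sequences,
    also on those that code nothing. *)
Definition value (R : realType) (b : nat -> bool) (i : nat * nat) : R :=
  fine (einfs (fun m => let r := odflt 0 (unpickle m) in
    if b (pickle (i, r)) then (ratr r)%:E else +oo%E) 0%N).

(** Bit sequences whose values are not regular give the zero path, so that
    decoding always yields càdlàg paths. *)
Definition path_of (R : realType) (b : nat -> bool) : R -> R :=
  if `[< regular (value R b) >] then fill (value R b) else cst 0.
Arguments path_of : clear implicits.

Lemma bit_index_pickle p : bit_index (pickle p) = p.
Proof. by rewrite /bit_index pickleK. Qed.

Lemma value_bits_of (R : realType) (f : R -> R) :
  value R (bits_of f) = (fun i => f (grid i)).
Proof.
apply/funext => i; rewrite /value.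
rewrite -[RHS]/(fine (f (grid i))%:E); congr fine.
rewrite /einfs /=; apply/eqP; rewrite eq_le; apply/andP; split; last first.
  apply: le_ereal_inf_tmp => _ [m _ <-] /=.
  rewrite /bits_of /bit_time bit_index_pickle /=.
  by case: ifP => [/ltW|_]; rewrite ?lee_fin ?leey.
apply/lee_addgt0Pr => e e0.
have /rat_in_itvoo[r] : f (grid i) < f (grid i) + e by rewrite ltrDl.
rewrite in_itv /= => /andP[fr re].
apply: ge_ereal_inf; exists (ratr r)%:E; last by rewrite -EFinD lee_fin ltW.
exists (pickle r) => //.
by rewrite pickleK /= /bits_of /bit_time bit_index_pickle /= fr.
Qed.

Lemma measurable_value (R : realType) i :
  measurable_fun setT (fun b : bit_space => value R b i).
Proof.
apply: (measurableT_comp (@fine_measurable R setT measurableT)) => /=.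
apply: (measurable_fun_einfs (D := setT)
  (f := fun m (b : bit_space) => let r := odflt 0 (unpickle m) in
    if b (pickle (i, r)) then (ratr r)%:E else +oo%E)) => m /=.
by apply: measurable_fun_ifT => //; exact: measurable_bit.
Qed.

(** Regularity is a combination of countably many inequalities between grid
    values, each of them measurable. *)
Lemma measurable_regular (R : realType) :
  measurable ([set b | regular (value R b)] : set bit_space).
Proof.
have mdist k i j :
    measurable ([set b | `|value R b i - value R b j| <= k] : set bit_space).
  rewrite -[X in measurable X]setTI.
  apply: (measurable_fun_le (f := fun b : bit_space => `|value R b i - value R b j|)
    (g := cst k)) => //.
  apply: (measurableT_comp (@normr_measurable R setT)) => /=.
  by apply: measurable_funB; exact: measurable_value.
pose ok (N k n : nat) (t : (nat * nat) * (nat * nat) * (nat * nat)) (b : bit_space) :=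
  let: (i, j, l) := t in
  grid i <= grid j :> R -> grid j <= grid l :> R -> grid j <= N%:R :> R ->
    grid l - grid i < n.+1%:R^-1 :> R ->
    `|value R b i - value R b j| <= k.+1%:R^-1 :> R \/
    `|value R b j - value R b l| <= k.+1%:R^-1 :> R.
have -> : [set b | regular (value R b)] =
    \bigcap_N \bigcap_k \bigcup_n ~` \bigcup_t ~` [set b | ok N k n t b].
  apply/seteqP; split=> b.
    move=> br N _ k _; have [n bn] := br N k; exists n => // -[[[i j] l] _].
    by apply; exact: bn.
  move=> bok N k; have [n _ bn] := bok N Logic.I k Logic.I.
  exists n => i j l ij jl jN il; apply: contrapT => nbb; apply: bn.
  by exists (i, j, l) => // /(_ ij jl jN il).
apply: bigcapT_measurable => N; apply: bigcapT_measurable => k.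
apply: bigcupT_measurable => n; apply: measurableC.
apply: countable_bigcupT_measurable; first exact: countableP.
move=> [[i j] l]; apply: measurableC.
have [c|nc] := pselect [/\ grid i <= grid j :> R, grid j <= grid l :> R,
    grid j <= N%:R :> R & grid l - grid i < n.+1%:R^-1 :> R].
  rewrite (_ : [set _ | _] =
    [set b | `|value R b i - value R b j| <= k.+1%:R^-1] `|`
    [set b | `|value R b j - value R b l| <= k.+1%:R^-1]).
    exact: measurableU.
  case: c => c1 c2 c3 c4; apply/seteqP; split=> b /=; first exact.
  by [].
rewrite (_ : [set _ | _] = setT) //; apply/seteqP; split=> b //= _ c1 c2 c3 c4.
by case: nc.
Qed.

Lemma path_of_cadlag (R : realType) b : cadlag (path_of R b).
Proof.
rewrite /path_of; case: asboolP => [|_]; first exact: fill_cadlag.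
by split=> t _; [exact: cvg_cst|exact: is_cvg_cst].
Qed.

Lemma path_of_bits_of (R : realType) (f : R -> R) t :
  cadlag f -> 0 <= t -> path_of R (bits_of f) t = f t.
Proof.
move=> fc t0; rewrite /path_of value_bits_of asboolT ?fill_grid //.
exact: cadlag_regular.
Qed.

(** The value at s < t is a limit of values at grid times in (s, t), so only bits
    with time before t are involved. *)
Lemma path_of_eq (R : realType) (b c : nat -> bool) (s t : R) :
  regular (value R b) -> regular (value R c) ->
  (forall n, bit_time R n < t -> b n = c n) -> 0 <= s -> s < t ->
  path_of R b s = path_of R c s.
Proof.
move=> br cr bc s0 st; rewrite /path_of !asboolT //.
have valE i : grid i < t -> value R b i = value R c i.
  move=> it; rewrite /value; congr (fine (einfs _ _)); apply/funext => m.
  by rewrite bc // /bit_time bit_index_pickle.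
have bcvg := fill_cvg br s0; apply: (cvg_unique _ bcvg) => //.
apply: cvg_trans (fill_cvg cr s0); apply: near_eq_cvg.
apply: filterS (grid_after_near s0 st) => n /andP[_ nt].
by rewrite /= valE.
Qed.

Lemma measurable_path_of (R : realType) (t : R) : 0 <= t ->
  measurable_fun setT (fun b : bit_space => path_of R b t).
Proof.
move=> t0.
apply: (measurable_fun_cvg (h := fun n (b : bit_space) =>
  if `[< regular (value R b) >] then value R b (after t n) else 0)).
  move=> n; apply: measurable_fun_ifT => //; last exact: measurable_value.
  apply: (measurable_fun_bool true); rewrite setTI.
  rewrite (_ : _ @^-1` _ = [set b | regular (value R b)]).
    exact: measurable_regular.
  by apply/seteqP; split=> b /= /asboolP.
move=> b _; rewrite /path_of; case: asboolP => br; last exact: cvg_cst.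
exact: fill_cvg.
Qed.

(** * Coupling of bit sequences *)

Definition bit_law (R : realType) d (T : measurableType d) (P : probability T R)
    (B : T -> nat -> bool) (k : nat) (s : k.-tuple bool) : R :=
  fine (P [set w | mkseq (B w) k = s]).
Arguments bit_law {R d T} P B k s.

(** Forgetting the bits whose time is not before t, by setting them to false,
    makes the partition by the remaining bits the fibers of a map. *)
Definition mask (R : realType) (tm : nat -> R) (t : R) (k : nat)
    (s : k.-tuple bool) : k.-tuple bool :=
  [tuple (tm i < t) && tnth s i | i < k].

Lemma bit_law_ge0 (R : realType) d (T : measurableType d) (P : probability T R)
    (B : T -> nat -> bool) k s : 0 <= bit_law P B k s.
Proof. exact: fine_ge0. Qed.

Lemma sum_bit_law (R : realType) d (T : measurableType d) (P : probability T R)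
    (B : T -> nat -> bool) k (phi : pred (seq bool)) :
  (forall n s, measurable [set w | mkseq (B w) n = s]) ->
  P [set w | phi (mkseq (B w) k)] =
  (\sum_(s : k.-tuple bool | phi s) bit_law P B k s)%:E.
Proof.
move=> mB; rewrite measure_mkseq // -sumEFin; apply: eq_bigr => s _.
by rewrite /bit_law fineK //; apply: fin_num_measure; exact: mB.
Qed.

Definition mexit_kernel (R : realType) (tm : nat -> R) (k : nat)
    (mu nu : k.-tuple bool -> R) (K : k.-tuple bool -> k.-tuple bool -> R) :=
  [/\ forall x y, 0 <= K x y,
    forall x, \sum_y K x y = mu x, forall y, \sum_x K x y = nu y &
    forall t, meet_mass (mask tm t (k := k)) mu nu <=
      \sum_x \sum_(y | mask tm t x == mask tm t y) K x y].

(** Ranking the bits by their times makes the partitions of all t a single chain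
    indexed by integers: the bits with time before t are exactly those whose
    rank is below the number of such bits. *)
Lemma mask_coupling (R : realType) (tm : nat -> R) (k : nat)
    (mu nu : k.-tuple bool -> R) :
  (forall x, 0 <= mu x) -> (forall x, 0 <= nu x) ->
  \sum_x mu x = 1 -> \sum_x nu x = 1 ->
  exists K, mexit_kernel tm mu nu K.
Proof.
move=> mu0 nu0 mu1 nu1.
pose rank (i : 'I_k) := #|[pred i' : 'I_k | tm i' < tm i]|.
pose p j (x : k.-tuple bool) := [tuple (rank i + j < k)%N && tnth x i | i < k].
have [|x y|K [K0 Krow Kcol Kmass]] :=
    mexit_finite (p := p) (n := k) mu0 nu0 mu1 nu1.
- move=> j x y /(congr1 (fun z : k.-tuple bool => tnth z)) pxy.
  apply: eq_from_tnth => i; have := congr1 (@^~ i) pxy.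
  rewrite /p !tnth_mktuple addnS; case: (ltnP (rank i + j).+1 k) => //= ij.
  by rewrite (ltn_trans _ ij).
- by apply: eq_from_tnth => i; rewrite /p !tnth_mktuple ltnNge leq_addl.
exists K; split=> // t.
pose r := #|[pred i : 'I_k | tm i < t]|.
have rk : (r <= k)%N by rewrite -[leqRHS](card_ord k) max_card.
have rankE i : (rank i + (k - r) < k)%N = (tm i < t).
  have -> : (rank i + (k - r) < k)%N = (rank i < r)%N.
    by rewrite addnC -ltn_subRL subKn.
  have [it|ti] := ltP (tm i) t.
    apply: proper_card; apply/properP; split.
      by apply/fintype.subsetP => i'; rewrite !inE => /lt_trans; apply.
    by exists i; rewrite !inE ?ltxx.
  apply/negbTE; rewrite -leqNgt; apply: subset_leq_card.
  by apply/fintype.subsetP => i'; rewrite !inE => /lt_le_trans; apply.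
have maskE : mask tm t (k := k) = p (k - r)%N.
  apply/funext => x; apply: eq_from_tnth => i.
  by rewrite /mask /p !tnth_mktuple rankE.
by rewrite maskE Kmass // leq_subr.
Qed.

Lemma sum_zip (R : realType) (k : nat)
    (K : k.-tuple bool -> k.-tuple bool -> R)
    (phi : k.-tuple bool -> k.-tuple bool -> bool) :
  \sum_(z : k.-tuple (bool * bool) |
      phi (map_tuple fst z) (map_tuple snd z))
    K (map_tuple fst z) (map_tuple snd z) =
  \sum_x \sum_(y | phi x y) K x y.
Proof.
rewrite pair_big_dep /=.
pose f (z : k.-tuple (bool * bool)) := (map_tuple fst z, map_tuple snd z).
have zipP (x y : k.-tuple bool) : size (zip x y) == k.
  by rewrite size_zip !size_tuple minnn.
pose g (xy : k.-tuple bool * k.-tuple bool) := Tuple (zipP xy.1 xy.2).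
have fK : cancel f g by move=> z; apply: val_inj => /=; rewrite zip_unzip.
have gK : cancel g f.
  move=> [x y]; congr pair; apply: val_inj.
    by apply: unzip1_zip; rewrite !size_tuple.
  by apply: unzip2_zip; rewrite !size_tuple.
by rewrite (reindex f) //=; exists g => ? _; [exact: fK|exact: gK].
Qed.

(** The limit of the greedy couplings of prefixes. Agreement at length n has at
    least the mass of agreement at any length k >= n, so the lower bound c on
    the meet masses passes to the limit for each n, and then to the
    intersection over n. *)
Lemma bit_coupling (R : realType) d1 d2 (T1 : measurableType d1)
    (T2 : measurableType d2) (P1 : probability T1 R) (P2 : probability T2 R)
    (B1 : T1 -> nat -> bool) (B2 : T2 -> nat -> bool) (tm : nat -> R) :
  (forall n s, measurable [set w | mkseq (B1 w) n = s]) ->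
  (forall n s, measurable [set w | mkseq (B2 w) n = s]) ->
  exists (d : measure_display) (T : measurableType d) (P : probability T R)
    (C1 C2 : T -> nat -> bool),
  [/\ (forall n s, measurable [set w | mkseq (C1 w) n = s]) /\
      (forall n s, measurable [set w | mkseq (C2 w) n = s]),
      forall n (phi : pred (seq bool)),
        P [set w | phi (mkseq (C1 w) n)] = P1 [set w | phi (mkseq (B1 w) n)],
      forall n (phi : pred (seq bool)),
        P [set w | phi (mkseq (C2 w) n)] = P2 [set w | phi (mkseq (B2 w) n)] &
      forall t : R,
        measurable [set w | forall i, tm i < t -> C1 w i = C2 w i] /\
        forall c : R,
        (forall k, c <= meet_mass (mask tm t (k := k)) (bit_law P1 B1 k)
                                  (bit_law P2 B2 k)) ->
        (c%:E <= P [set w | forall i, (tm i < t)%R -> C1 w i = C2 w i])%E].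
Proof.
move=> mB1 mB2.
have law1 d' (T' : measurableType d') (P' : probability T' R)
    (B' : T' -> nat -> bool) k :
    (forall n s, measurable [set w | mkseq (B' w) n = s]) ->
    \sum_s bit_law P' B' k s = 1.
  move=> mB'; apply: EFin_inj; rewrite -(sum_bit_law P' k predT mB').
  by rewrite -(probability_setT P'); congr (P' _); apply/seteqP; split.
have exK k := mask_coupling tm (@bit_law_ge0 _ _ _ P1 B1 k)
  (@bit_law_ge0 _ _ _ P2 B2 k) (law1 _ _ P1 B1 k mB1) (law1 _ _ P2 B2 k mB2).
pose K k := projT1 (cid (exK k)).
have Kk k : mexit_kernel tm _ _ (K k) := projT2 (cid (exK k)).
pose Q k (z : k.-tuple (bool * bool)) :=
  K k (map_tuple fst z) (map_tuple snd z).
have Q0 k z : 0 <= Q k z by have [K0 _ _ _] := Kk k; exact: K0.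
have Q1 k : \sum_z Q k z = 1.
  rewrite (sum_zip (K k) (fun _ _ => true)) /=; have [_ Krow _ _] := Kk k.
  by rewrite (eq_bigr _ (fun x _ => Krow x)) law1.
have [d [T [P [Z [mZ PZ]]]]] := sequence_compactness (false, false) Q0 Q1.
pose C1 w n := (Z n w).1; pose C2 w n := (Z n w).2.
pose W n w := [tuple of mkseq (Z ^~ w) n].
have mW n s : measurable [set w | W n w = s].
  rewrite (_ : [set w | _] = [set w | mkseq (Z ^~ w) n = s]) //.
  apply/seteqP; split=> w /= [Ws]; first by rewrite -Ws.
  exact: val_inj.
have mpre n (psi : pred (seq (bool * bool))) :
    measurable [set w | psi (mkseq (Z ^~ w) n)].
  exact: (measurable_fibers (@mW n) (fun s => psi s)).
have C1E w n : mkseq (C1 w) n = map fst (mkseq (Z ^~ w) n).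
  by rewrite /mkseq -map_comp.
have C2E w n : mkseq (C2 w) n = map snd (mkseq (Z ^~ w) n).
  by rewrite /mkseq -map_comp.
have mC1 n s : measurable [set w | mkseq (C1 w) n = s].
  have -> : [set w | mkseq (C1 w) n = s] =
      [set w | [pred z | map fst z == s] (mkseq (Z ^~ w) n)].
    by apply/seteqP; split=> w /=; rewrite C1E => /eqP.
  exact: mpre.
have mC2 n s : measurable [set w | mkseq (C2 w) n = s].
  have -> : [set w | mkseq (C2 w) n = s] =
      [set w | [pred z | map snd z == s] (mkseq (Z ^~ w) n)].
    by apply/seteqP; split=> w /=; rewrite C2E => /eqP.
  exact: mpre.
(* An inequality between two probabilities that holds for every event holds
   for its complement too, hence is an equality. *)
have eq_of_le d' (T' : measurableType d') (P' : probability T' R)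
    (B' : T' -> nat -> bool) (C : T -> nat -> bool) :
    (forall n s, measurable [set w | mkseq (B' w) n = s]) ->
    (forall n s, measurable [set w | mkseq (C w) n = s]) ->
    (forall n (phi : pred (seq bool)),
       P' [set w | phi (mkseq (B' w) n)] <= P [set w | phi (mkseq (C w) n)])%E ->
    forall n (phi : pred (seq bool)),
      P [set w | phi (mkseq (C w) n)] = P' [set w | phi (mkseq (B' w) n)].
  move=> mB' mC le n phi; apply/eqP; rewrite eq_le le andbT.
  have := le n (predC phi).
  rewrite (_ : [set w | predC phi (mkseq (B' w) n)] =
    ~` [set w | phi (mkseq (B' w) n)]); last by apply/seteqP; split=> w /= /negP.
  rewrite (_ : [set w | predC phi (mkseq (C w) n)] =
    ~` [set w | phi (mkseq (C w) n)]); last by apply/seteqP; split=> w /= /negP.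
  have mphi' := measurable_mkseq mB' n phi; have mphi := measurable_mkseq mC n phi.
  rewrite !probability_setC //.
  rewrite -(fineK (fin_num_measure P' _ mphi')) -(fineK (fin_num_measure P _ mphi)).
  by rewrite -!EFinB !lee_fin lerD2l lerN2.
have tk (A : eqType) k n (b : nat -> A) : (n <= k)%N -> take n (mkseq b k) = mkseq b n.
  by move=> nk; rewrite /mkseq -map_take take_iota (minn_idPl nk).
exists d, T, P, C1, C2; split=> //.
- apply: eq_of_le => // n phi; rewrite (sum_bit_law P1 n phi mB1).
  rewrite (_ : [set w | phi (mkseq (C1 w) n)] =
    [set w | [pred z | phi (map fst z)] (mkseq (Z ^~ w) n)]); last first.
    by apply/seteqP; split=> w /=; rewrite C1E.
  apply: PZ; exists n => // k nk /=.
  rewrite -lee_fin -(sum_bit_law P1 n phi mB1).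
  rewrite (_ : [set w | phi (mkseq (B1 w) n)] =
    [set w | [pred s | phi (take n s)] (mkseq (B1 w) k)]); last first.
    by apply/seteqP; split=> w /=; rewrite tk.
  rewrite sum_bit_law // lee_fin.
  under eq_bigl do rewrite map_take.
  rewrite (sum_zip (K k) (fun x _ => phi (take n x))) /=.
  have [_ Krow _ _] := Kk k; rewrite big_mkcond; apply: ler_sum => x _.
  by rewrite /=; case: ifP => _; rewrite ?Krow ?big_pred0_eq.
- apply: eq_of_le => // n phi; rewrite (sum_bit_law P2 n phi mB2).
  rewrite (_ : [set w | phi (mkseq (C2 w) n)] =
    [set w | [pred z | phi (map snd z)] (mkseq (Z ^~ w) n)]); last first.
    by apply/seteqP; split=> w /=; rewrite C2E.
  apply: PZ; exists n => // k nk /=.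
  rewrite -lee_fin -(sum_bit_law P2 n phi mB2).
  rewrite (_ : [set w | phi (mkseq (B2 w) n)] =
    [set w | [pred s | phi (take n s)] (mkseq (B2 w) k)]); last first.
    by apply/seteqP; split=> w /=; rewrite tk.
  rewrite sum_bit_law // lee_fin.
  under eq_bigl do rewrite map_take.
  rewrite (sum_zip (K k) (fun _ y => phi (take n y))) /=.
  have [_ _ Kcol _] := Kk k.
  rewrite (exchange_big_dep (fun y : k.-tuple bool => phi (take n y))) //=.
  by apply: ler_sum => y phiy; rewrite phiy Kcol.
move=> t; pose psi n (z : seq (bool * bool)) :=
  [forall i : 'I_n, (tm i < t) ==>
     ((nth (false, false) z i).1 == (nth (false, false) z i).2)].
pose E n := [set w | psi n (mkseq (Z ^~ w) n)].
have EE n w : E n w <-> forall i, (i < n)%N -> tm i < t -> C1 w i = C2 w i.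
  split=> [/forallP Ew i ilt it|Ew].
    have /implyP/(_ it) := Ew (Ordinal ilt).
    by rewrite nth_mkseq // => /eqP.
  apply/forallP => i; apply/implyP => it; rewrite nth_mkseq //.
  exact/eqP/Ew.
have -> : [set w | forall i, tm i < t -> C1 w i = C2 w i] = \bigcap_n E n.
  apply/seteqP; split=> w /=.
    by move=> Cw n _; apply/EE => i _; exact: Cw.
  by move=> Ew i it; have /EE := Ew i.+1 Logic.I; apply.
have mE n : measurable (E n) by exact: mpre.
have mcapE : measurable (\bigcap_n E n) by exact: bigcapT_measurable.
split=> // c cmeet.
have cE n : (c%:E <= P (E n))%E.
  apply: PZ; exists n => // k nk /=.
  have [_ _ _ Kmass] := Kk k; apply: (le_trans (cmeet k)).
  apply: (le_trans (Kmass t)).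
  rewrite -(sum_zip (K k) (fun x y => mask tm t x == mask tm t y)).
  rewrite big_mkcond [leRHS]big_mkcond /=; apply: ler_sum => z _.
  case: ifP => [/eqP mz|_]; last by case: ifP => // _; exact: Q0.
  rewrite ifT //; apply/forallP => i; apply/implyP => it; rewrite nth_take //.
  have ik : (i < k)%N by apply: leq_trans nk.
  have := congr1 (fun s : k.-tuple bool => tnth s (Ordinal ik)) mz.
  rewrite /mask !tnth_mktuple /= it /= !tnth_map.
  by rewrite (tnth_nth (false, false)) /= => ->.
have cv : P \o E @ \oo --> P (\bigcap_n E n).
  apply: nonincreasing_cvg_mu => //.
  - by rewrite (le_lt_trans (probability_le1 P (mE 0%N))) // ltry.
  - move=> n m nm; apply/subsetPset => w /EE Ew; apply/EE => i ilt.
    by apply: Ew; exact: leq_trans nm.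
apply: (closed_cvg _ (@closed_ereal_le_ereal _ c%:E) _ _ cv) => //.
by apply: nearW => n; exact: cE.
Qed.

(** * The meet of two laws *)

(** On a positive set H of a Hahn decomposition of mu - nu the smaller of the
    two measures is nu, on its complement it is mu. *)
Lemma exists_meet (R : realType) d (T : measurableType d)
    (mu nu : probability T R) :
  exists (m : {measure set T -> \bar R}) (H : set T),
    [/\ measurable H, is_meet mu nu m & m setT = (nu H + mu (~` H))%E].
Proof.
pose diff : {charge set T -> \bar R} := cadd (charge_of_finite_measure mu)
  (cscale (-1) (charge_of_finite_measure nu)).
have diffE D : measurable D -> diff D = (mu D - nu D)%E.
  by move=> mD; rewrite /diff /= /cadd /= /cscale /= EFinN mulN1e.
have [H [N [[mH posH] [mN negN] HN HN0]]] := Hahn_decomposition diff.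
have NE : N = ~` H.
  apply/seteqP; split=> x; first by move=> Nx Hx; rewrite -[False]/(set0 x) -HN0.
  by have : [set: T] x by []; rewrite -HN => -[].
subst N.
have nu_le D : measurable D -> D `<=` H -> (nu D <= mu D)%E.
  by move=> mD DH; rewrite -sube_ge0 ?fin_num_measure // -diffE // posH.
have mu_le D : measurable D -> D `<=` ~` H -> (mu D <= nu D)%E.
  by move=> mD DH; rewrite -sube_le0 ?fin_num_measure // -diffE // negN.
pose m : {measure set T -> \bar R} := measure_add (mrestr nu mH) (mrestr mu mN).
have mE D : m D = (nu (D `&` H) + mu (D `&` ~` H))%E.
  exact: measure_addE.
have split_ (p : {measure set T -> \bar R}) D : measurable D ->
    p D = (p (D `&` H) + p (D `&` ~` H))%E.
  move=> mD; rewrite -measureU; [|exact: measurableI|exact: measurableI|].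
    by rewrite -setIUr setUv setIT.
  by rewrite setIACA setICr setI0.
exists m, H; split=> //; last by rewrite mE !setTI.
split=> [D mD|m' m'_le D mD].
  rewrite mE le_min; apply/andP; split.
    rewrite (split_ mu D mD) leeD2r //; apply: nu_le; first exact: measurableI.
    exact: subIsetr.
  rewrite (split_ nu D mD) leeD2l //; apply: mu_le; first exact: measurableI.
  exact: subIsetr.
rewrite mE (split_ m' D mD); apply: leeD.
  have := m'_le (D `&` H) (measurableI _ _ mD mH).
  by rewrite le_min => /andP[].
have := m'_le (D `&` ~` H) (measurableI _ _ mD mN).
by rewrite le_min => /andP[].
Qed.

(** * Processes as random points of a path space *)

Lemma measurable_to_paths (R : realType) (I : set R) d (T : measurableType d)
    (F : T -> path_space I) :
  (forall s : I, measurable_fun setT (fun w => F w s)) -> measurable_fun setT F.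
Proof.
move=> mF; apply: (@measurability _ _ _ (path_space I) setT F (coordinate_sets I)) => //.
move=> _ [_ [s _ [A mA <-]] <-]; rewrite !setTI.
by rewrite -[X in measurable X]setTI; exact: mF.
Qed.

Lemma measurable_coordinate (R : realType) (I : set R) (s : I) :
  measurable_fun setT (fun g : path_space I => g s).
Proof.
move=> _ A mA; apply: sub_sigma_algebra; exists s => //.
by exists A.
Qed.

Lemma measurable_restrict_path (R : realType) d (T : measurableType d)
    (X : R -> T -> R) (I : set R) :
  cadlag_process X -> I `<=` `[0, +oo[ ->
  measurable_fun setT (restrict_path X I).
Proof.
move=> [mX _] I0; apply: measurable_to_paths => s; apply: mX.
by have := I0 _ (set_mem (valP s)); rewrite /= in_itv /= andbT.
Qed.

Lemma path_law_probability (R : realType) d (T : measurableType d)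
    (P : probability T R) (X : R -> T -> R) (I : set R) :
  cadlag_process X -> I `<=` `[0, +oo[ ->
  exists Q : probability (path_space I) R, Q = path_law P X I :> (set _ -> \bar R).
Proof.
move=> cX I0; have mX := measurable_restrict_path cX I0.
pose mu : {measure set (path_space I) -> \bar R} :=
  pushforward P (restrict_path X I).
have muT : mu mX setT = 1%E.
  by rewrite /mu /= /pushforward preimage_setT probability_setT.
pose PM := Measure_isProbability.Build _ _ _ (mu mX) muT.
pose Q : probability (path_space I) R := HB.pack (Measure.sort (mu mX)) PM.
by exists Q.
Qed.

Definition process_bits (R : realType) (T : Type) (X : R -> T -> R) (w : T) :
  nat -> bool := bits_of (X ^~ w).

Definition decoded (R : realType) (T : Type) (C : T -> nat -> bool) (t : R)
  (w : T) : R := path_of R (C w) t.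

Lemma measurable_process_bits (R : realType) d (T : measurableType d)
    (X : R -> T -> R) : cadlag_process X ->
  forall n s, measurable [set w | mkseq (process_bits X w) n = s].
Proof.
move=> [mX _]; apply: measurable_mkseq_bits => n.
have mn : measurable_fun setT (fun w => X (bit_time R n) w < ratr (bit_index n).2).
  by apply: measurable_fun_ltr => //; apply: mX; exact: grid_ge0.
exact: (measurable_bool_fiber true mn).
Qed.

Lemma cadlag_decoded (R : realType) d (T : measurableType d)
    (C : T -> nat -> bool) :
  measurable_fun setT (C : T -> bit_space) -> cadlag_process (@decoded R T C).
Proof.
move=> mC; split=> [t t0|w]; last exact: path_of_cadlag.
exact: (measurableT_comp (measurable_path_of t0) mC).
Qed.

(** Decoding is a measurable map from bits to paths on I that turns the bits of
    X into X, so equality of bit laws transfers to path laws. *)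
Lemma path_law_decoded (R : realType) d1 d2 (T1 : measurableType d1)
    (T2 : measurableType d2) (P1 : probability T1 R) (P2 : probability T2 R)
    (X : R -> T1 -> R) (C : T2 -> nat -> bool) (I : set R) :
  cadlag_process X -> I `<=` `[0, +oo[ ->
  (forall A : set bit_space, measurable A ->
     P2 (C @^-1` A) = P1 (process_bits X @^-1` A)) ->
  forall A, measurable A ->
    path_law P2 (decoded C) I A = path_law P1 X I A.
Proof.
move=> [_ cX] I0 PC A mA.
pose Psi (b : bit_space) : path_space I := fun s => path_of R b (val s).
have mPsi : measurable_fun setT Psi.
  apply: measurable_to_paths => s; apply: measurable_path_of.
  by have := I0 _ (set_mem (valP s)); rewrite /= in_itv /= andbT.
have mPA : measurable (Psi @^-1` A).
  by rewrite -[X in measurable X]setTI; exact: mPsi.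
rewrite /path_law /pushforward.
rewrite (_ : restrict_path (decoded C) I @^-1` A = C @^-1` (Psi @^-1` A)) //.
rewrite PC //; congr (P1 _); apply/seteqP.
have XE w : Psi (process_bits X w) = restrict_path X I w.
  apply/funext => s; apply: path_of_bits_of => //.
  by have := I0 _ (set_mem (valP s)); rewrite /= in_itv /= andbT.
by split=> w /=; rewrite XE.
Qed.

Lemma cadlag_eq_before (R : realType) (f g : R -> R) (t : R) :
  cadlag f -> cadlag g -> (forall i, grid i < t -> f (grid i) = g (grid i)) ->
  forall s, 0 <= s -> s < t -> f s = g s.
Proof.
move=> [fr _] [gr _] fg s s0 st.
have lim_at (h : R -> R) : h u @[u --> s^'+] --> h s ->
    h (grid (after s n)) @[n --> \oo] --> h s.
  move/cvg_at_rightP; apply; split; last exact: grid_after_cvg.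
  by move=> n; exact: grid_after_gt.
apply: (cvg_unique _ (lim_at _ (fr s s0))) => //.
apply: cvg_trans (lim_at _ (gr s s0)); apply: near_eq_cvg.
apply: filterS (grid_after_near s0 st) => n /andP[_ nt].
by rewrite /= fg.
Qed.

Definition agreement (R : realType) (T : Type) (Y1 Y2 : R -> T -> R) (t : R) :
  set T := [set w | forall s, 0 <= s -> s < t -> Y1 s w = Y2 s w].

(** Right-continuity reduces agreement to grid times. *)
Lemma measurable_agreement (R : realType) d (T : measurableType d)
    (Y1 Y2 : R -> T -> R) (t : R) :
  cadlag_process Y1 -> cadlag_process Y2 -> measurable (agreement Y1 Y2 t).
Proof.
move=> [mY1 cY1] [mY2 cY2].
have -> : agreement Y1 Y2 t = ~` \bigcup_i
    (if grid i < t then ~` [set w | Y1 (grid i) w = Y2 (grid i) w] else set0).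
  apply/seteqP; split=> w.
    move=> Yw [i _]; case: ifP => // it; apply; apply: Yw => //.
    exact: grid_ge0.
  move=> Yw; apply: (cadlag_eq_before (cY1 w) (cY2 w)) => i it.
  by apply: contrapT => Yn; apply: Yw; exists i => //; rewrite it.
apply: measurableC; apply: countable_bigcupT_measurable => [|i].
  exact: countableP.
case: ifP => // _; apply: measurableC.
have mi : measurable_fun setT (fun w => Y1 (grid i) w == Y2 (grid i) w).
  by apply: measurable_fun_eqr; [apply: mY1|apply: mY2]; exact: grid_ge0.
have := measurable_bool_fiber true mi; congr (measurable _).
by apply/seteqP; split=> w /= /eqP.
Qed.

(** When the paths agree on [0, t), either that common path is in H and so is the
    second one, or it is outside and so is the first one. With H from
    [exists_meet] the bound is the mass of the meet. *)
Lemma coupling_inequality (R : realType) d (T : measurableType d)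
    (P : probability T R) (Y1 Y2 : R -> T -> R) (t : R)
    (H : set (path_space (`[0, t[%classic : set R))) :
  cadlag_process Y1 -> cadlag_process Y2 -> measurable H ->
  (P (agreement Y1 Y2 t) <=
     path_law P Y2 `[0%R, t[ H + path_law P Y1 `[0%R, t[ (~` H))%E.
Proof.
move=> cY1 cY2 mH; have mA := measurable_agreement t cY1 cY2.
have I0 : (`[0, t[%classic : set R) `<=` `[0, +oo[.
  by move=> u /=; rewrite !in_itv /= andbT => /andP[].
have mY1 := measurable_restrict_path cY1 I0.
have mY2 := measurable_restrict_path cY2 I0.
have mpre (Y : R -> T -> R) B : measurable_fun setT (restrict_path Y `[0, t[) ->
    measurable B -> measurable (restrict_path Y `[0, t[ @^-1` B).
  by move=> mY mB; rewrite -[X in measurable X]setTI; exact: mY.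
have AE w : agreement Y1 Y2 t w ->
    restrict_path Y1 `[0, t[ w = restrict_path Y2 `[0, t[ w.
  move=> Aw; apply/funext => s.
  have := set_mem (valP s); rewrite /= in_itv /= => /andP[s0 st].
  exact: Aw.
have mH' : measurable (~` H) by exact: measurableC.
apply: (@le_trans _ _ (P ((restrict_path Y2 `[0, t[ @^-1` H) `|`
    (restrict_path Y1 `[0, t[ @^-1` (~` H))))).
  apply: le_measure; rewrite ?inE //.
    by apply: measurableU; exact: mpre.
  move=> w Aw; have [Hw|nHw] := pselect (H (restrict_path Y1 `[0, t[ w)).
    by left; rewrite /preimage /= -AE.
  by right.
by apply: measureU2; exact: mpre.
Qed.

(** The masked bits of a path are functions of its restriction to [0, t): a bit
    is false when its time is not in that interval. *)
Definition path_bits (R : realType) (t : R) (k : nat)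
    (g : path_space (`[0, t[%classic : set R)) : k.-tuple bool :=
  [tuple if insub (bit_time R i) is Some s
         then g s < ratr (bit_index i).2 else false | i < k].

Lemma measurable_path_bits (R : realType) (t : R) (k : nat) s :
  measurable [set g | path_bits (t := t) k g = s].
Proof.
have -> : [set g | path_bits (t := t) k g = s] =
    \bigcap_(i : 'I_k) [set g | tnth (path_bits k g) i = tnth s i].
  apply/seteqP; split=> g /=.
    by move=> <- i _.
  by move=> gs; apply: eq_from_tnth => i; exact: gs.
apply: fin_bigcap_measurable => [|i _]; first exact: finite_finset.
have mi : measurable_fun setT (fun g : path_space (`[0, t[%classic : set R) =>
    tnth (path_bits k g) i).
  rewrite (_ : (fun g => _) = fun g =>
      if insub (bit_time R i) is Some s
      then g s < ratr (bit_index i).2 else false); last first.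
    by apply/funext => g; rewrite tnth_mktuple.
  case: insub => [u|//]; apply: measurable_fun_ltr => //.
  exact: measurable_coordinate.
exact: measurable_bool_fiber.
Qed.

Lemma path_bits_restrict (R : realType) d (T' : measurableType d)
    (X : R -> T' -> R) (t : R) (k : nat) w :
  path_bits k (restrict_path X `[0, t[ w) =
  mask (bit_time R) t [tuple of mkseq (process_bits X w) k].
Proof.
apply: eq_from_tnth => i; rewrite /path_bits /mask !tnth_mktuple.
rewrite (tnth_nth false) /= nth_mkseq // /process_bits /bits_of.
have tE : (bit_time R i \in (`[0, t[%classic : set R)) = (bit_time R i < t).
  by rewrite mem_setE in_itv /= grid_ge0.
case: insubP => [u uI uE|uI].
  have -> : bit_time R i < t by rewrite -tE; exact: uI.
  by rewrite /restrict_path uE.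
have -> : (bit_time R i < t) = false by rewrite -tE; exact: negbTE uI.
by [].
Qed.

(** The fibers of [path_bits] partition the path space, and on each of them the
    meet is at most the minimum of the two laws. *)
Lemma meet_le_meet_mass (R : realType) d1 d2 (T1 : measurableType d1)
    (T2 : measurableType d2) (P1 : probability T1 R) (P2 : probability T2 R)
    (X1 : R -> T1 -> R) (X2 : R -> T2 -> R) (t : R) (k : nat)
    (m : {measure set (path_space (`[0, t[%classic : set R)) -> \bar R}) :
  cadlag_process X1 -> cadlag_process X2 ->
  below_both (path_law P1 X1 `[0, t[) (path_law P2 X2 `[0, t[) m ->
  (m setT <= (meet_mass (mask (bit_time R) t (k := k))
     (bit_law P1 (process_bits X1) k) (bit_law P2 (process_bits X2) k))%:E)%E.
Proof.
move=> cX1 cX2 mle.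
have fiberE d (T : measurableType d) (P : probability T R) (X : R -> T -> R) c :
    cadlag_process X ->
    path_law P X `[0, t[ [set g | path_bits k g = c] =
    (fiber_mass (mask (bit_time R) t (k := k))
       (bit_law P (process_bits X) k) c)%:E.
  move=> cX; have mX := measurable_process_bits cX.
  rewrite /path_law /pushforward.
  have -> : restrict_path X `[0, t[ @^-1` [set g | path_bits k g = c] =
      [set w | [pred s : seq bool | [exists x : k.-tuple bool,
        (val x == s) && (mask (bit_time R) t x == c)]]
        (mkseq (process_bits X w) k)].
    apply/seteqP; split=> w /=; rewrite path_bits_restrict //.
      by move=> <-; apply/existsP; exists [tuple of mkseq (process_bits X w) k];
        rewrite !eqxx.
    move=> /existsP[x /andP[/eqP xE /eqP <-]].
    by congr (mask _ _ _); apply: val_inj => /=; rewrite -xE.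
  rewrite sum_bit_law //; congr (_%:E); apply: eq_bigl => x /=.
  apply/existsP/idP => [[y /andP[/eqP/val_inj -> //]]|xc].
  by exists x; rewrite eqxx.
rewrite (_ : setT = [set g | predT (path_bits (t := t) k g)]); last first.
  by apply/seteqP; split.
rewrite (measure_fibers (@measurable_path_bits R t k)) /meet_mass -sumEFin.
apply: lee_sum => c _; rewrite EFin_min -!fiberE //.
by apply: mle; exact: measurable_path_bits.
Qed.

Theorem theorem25 (R : realType)
    (dp dm : measure_display)
    (Tp : measurableType dp) (Tm : measurableType dm)
    (Pp : probability Tp R) (Pm : probability Tm R)
    (Xp : R -> Tp -> R) (Xm : R -> Tm -> R) (x0 : R)
    (cadlag_Xp : cadlag_process Xp) (cadlag_Xm : cadlag_process Xm)
    (start_Xp : {ae Pp, forall w, Xp 0 w = x0})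
    (start_Xm : {ae Pm, forall w, Xm 0 w = x0}) :
  exists (d : measure_display) (T : measurableType d) (P : probability T R)
    (Yp Ym : R -> T -> R),
    is_mexit_coupling Pp Pm P Xp Xm Yp Ym.
Proof.
have mBp := measurable_process_bits cadlag_Xp.
have mBm := measurable_process_bits cadlag_Xm.
have [d [T [P [Cp [Cm [[mCp mCm] lawp lawm agree]]]]]] :=
  bit_coupling Pp Pm (bit_time R) mBp mBm.
have mBp' := measurable_to_bits mBp; have mBm' := measurable_to_bits mBm.
have mCp' := measurable_to_bits mCp; have mCm' := measurable_to_bits mCm.
have {}lawp := bit_law_unique mCp' mBp' lawp.
have {}lawm := bit_law_unique mCm' mBm' lawm.
have cYp := @cadlag_decoded R _ _ _ mCp'.
have cYm := @cadlag_decoded R _ _ _ mCm'.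
exists d, T, P, (decoded Cp), (decoded Cm); split.
  by split=> // A mA; exact: path_law_decoded.
move=> t t0.
have I0 : (`[0, t[%classic : set R) `<=` `[0, +oo[.
  by move=> u /=; rewrite !in_itv /= andbT => /andP[].
have [Qp QpE] := path_law_probability Pp cadlag_Xp I0.
have [Qm QmE] := path_law_probability Pm cadlag_Xm I0.
have [m [H [mH meet_m mT]]] := exists_meet Qp Qm.
rewrite QpE QmE in meet_m mT.
exists m; split=> //; apply/eqP; rewrite eq_le; apply/andP; split.
  rewrite mT -(path_law_decoded cadlag_Xm I0 lawm) //.
  rewrite -(path_law_decoded cadlag_Xp I0 lawp); last exact: measurableC.
  exact: coupling_inequality.
have mass k := meet_le_meet_mass k cadlag_Xp cadlag_Xm meet_m.1.
have mTfin : m setT \is a fin_num.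
  by rewrite ge0_fin_numE // (le_lt_trans (mass 0%N)) // ltry.
have good C d' (T' : measurableType d') (P' : probability T' R)
    (X : R -> T' -> R) : cadlag_process X ->
    measurable_fun setT (C : T -> bit_space) ->
    (forall A : set bit_space, measurable A ->
       P (C @^-1` A) = P' (process_bits X @^-1` A)) ->
    P [set w | regular (value R (C w))] = 1%E.
  move=> [_ cX] mC lawC; have := lawC _ (measurable_regular R).
  rewrite /preimage /= => ->; rewrite -(probability_setT P'); congr (P' _).
  apply/seteqP; split=> // w _ /=; rewrite /process_bits value_bits_of.
  exact: cadlag_regular (cX w).
have mgood C : measurable_fun setT (C : T -> bit_space) ->
    measurable [set w | regular (value R (C w))].
  move=> mC; rewrite -[X in measurable X]setTI.
  exact: (mC measurableT _ (measurable_regular R)).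
have goodp := good _ _ _ _ _ cadlag_Xp mCp' lawp.
have goodm := good _ _ _ _ _ cadlag_Xm mCm' lawm.
have [mE Ege] := agree t.
set E := [set w | _] in mE Ege.
have PE : (m setT <= P E)%E.
  by rewrite -(fineK mTfin); apply: Ege => k; rewrite -lee_fin fineK.
pose bad C := ~` [set w : T | regular (value R (C w))].
have mbad C : measurable_fun setT (C : T -> bit_space) -> measurable (bad C).
  by move=> mC; apply: measurableC; exact: mgood.
have Pbad C : measurable_fun setT (C : T -> bit_space) ->
    P [set w | regular (value R (C w))] = 1%E -> P (bad C) = 0%E.
  by move=> mC PC; rewrite probability_setC ?PC ?subee //; exact: mgood.
have mA := measurable_agreement t cYp cYm.
apply: (le_trans PE); apply: (@le_trans _ _
  (P (agreement (decoded Cp) (decoded Cm) t `|` (bad Cp `|` bad Cm)))).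
  apply: le_measure; rewrite ?inE //.
    by do 2 (apply: measurableU => //); exact: mbad.
  move=> w Ew; have [pw|] := pselect (regular (value R (Cp w))); last by right; left.
  have [mw|] := pselect (regular (value R (Cm w))); last by right; right.
  by left=> s s0 st; apply: (path_of_eq pw mw Ew).
apply: (le_trans (measureU2 _ _ _)) => //.
  by apply: measurableU; exact: mbad.
rewrite -[leRHS]adde0 leeD2l //.
apply: (@le_trans _ _ (P (bad Cp) + P (bad Cm))%E).
  by apply: measureU2; exact: mbad.
by rewrite !Pbad // adde0.
Qed.
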